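(* There exists $n_0$ such that for every integer $n\ge n_0$ the graph $F_1\big(\lfloor\frac{n-11}{2}\rfloor,\lceil\frac{n-7}{2}\rceil\big)$ is, up to isomorphism, the unique graph of maximum spectral radius among all triangle-free graphs on $n$ vertices with chromatic number at least $4$. That is, $F_1\big(\lfloor\frac{n-11}{2}\rfloor,\lceil\frac{n-7}{2}\rceil\big)$ is an $n$-vertex triangle-free graph with chromatic number at least $4$, and every $n$-vertex triangle-free graph $G$ with $\chi(G)\ge 4$ satisfies $$\rho(G)\le \rho\Big(F_1\big(\lfloor\tfrac{n-11}{2}\rfloor,\lceil\tfrac{n-7}{2}\rceil\big)\Big),$$ with equality if and only if $G\cong F_1\big(\lfloor\frac{n-11}{2}\rfloor,\lceil\frac{n-7}{2}\rceil\big)$.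
   Context: All graphs are finite and simple. $\rho(G)$ denotes the spectral radius (largest eigenvalue) of the adjacency matrix of $G$, and $\chi(G)$ its chromatic number. A graph is triangle-free if it contains no copy of $K_3$ as a subgraph. The graph $F_1$ (the Grötzsch graph) has the $11$ vertices $v_{13},v_{23},v_1,v_2,x,u_1,u_2,u_3,w_{13},w_{23},y$ and the following $20$ edges: $yv_{13},\ yv_{23},\ yv_1,\ yv_2,\ yx$; $u_1u_2,\ u_1v_{13},\ u_1v_1,\ u_1w_{13}$; $u_2v_{23},\ u_2v_2,\ u_2w_{23}$; $u_3v_{13},\ u_3v_{23},\ u_3w_{13},\ u_3w_{23}$; $xw_{13},\ xw_{23}$; $v_1w_{23}$; $v_2w_{13}$. For positive integers $s,t$, $F_1(s,t)$ is the graph on $s+t+9$ vertices obtained from $F_1$ by replacing the vertices $x$ and $y$ with independent sets of sizes $s$ and $t$, respectively, where two vertices of $F_1(s,t)$ are adjacent if and only if their corresponding original vertices in $F_1$ are adjacent. In the paper, $G(r,s)$ denotes a $K_{r+1}$-free graph of order $n$ with chromatic number at least $s$ that maximizes the spectral radius; the theorem is the determination of the unique such graph $G(2,4)$. *)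

(* Defs.v *)
From HB Require Import structures.
From mathcomp Require Import all_boot all_order all_algebra.
From mathcomp Require Import spectral polyrcf complex.
From mathcomp Require Import classical_sets reals.

Set Implicit Arguments.
Unset Strict Implicit.
Unset Printing Implicit Defensive.

Import Order.TTheory GRing.Theory Num.Theory.

Record sgraph := SGraph {
  vertex :> finType;
  adj : rel vertex;
  adj_sym : symmetric adj;
  adj_irr : irreflexive adj }.

Definition isomorphic (G H : sgraph) : Prop :=
  exists2 f : G -> H, bijective f & {mono f : a b / adj a b}.

(* Not necessarily induced. *)
Definition contains_copy (H G : sgraph) : Prop :=
  exists2 f : H -> G, injective f & {homo f : a b / adj a b}.

Lemma complete_sym k : symmetric (fun i j : 'I_k => i != j).
Proof. by move=> i j; rewrite eq_sym. Qed.

Lemma complete_irr k : irreflexive (fun i j : 'I_k => i != j).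
Proof. by move=> i; rewrite eqxx. Qed.

Definition complete (k : nat) : sgraph :=
  SGraph (@complete_sym k) (@complete_irr k).

Definition triangle_free (G : sgraph) : Prop := ~ contains_copy (complete 3) G.

Definition colorable (G : sgraph) (k : nat) : bool :=
  [exists f : {ffun G -> 'I_k},
    [forall a : G, forall b : G, adj a b ==> (f a != f b)]].

Lemma ex_colorable (G : sgraph) : exists k, colorable G k.
Proof.
exists #|G|; apply/existsP; exists [ffun a => enum_rank a].
apply/forallP => a; apply/forallP => b; apply/implyP => ab; rewrite !ffunE.
by apply: contraL ab => /eqP/enum_rank_inj ->; rewrite adj_irr.
Qed.

Definition chromatic_number (G : sgraph) : nat := ex_minn (ex_colorable G).

Definition adjmx (R : realType) (G : sgraph) : 'M[R]_#|G| :=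
  (\matrix_(i, j) (adj (enum_val i) (enum_val j))%:R)%R.

(* By lemma spectral_radius_max below, this supremum is a maximum as soon as
   the graph has a vertex. *)
Definition spectral_radius (R : realType) (G : sgraph) : R :=
  sup [set a : R | eigenvalue (adjmx R G) a]%classic.

Lemma adjmx_eigenvalue (R : realType) (G : sgraph) :
  0 < #|G| -> exists a : R, eigenvalue (adjmx R G) a.
Proof.
move=> G_gt0; pose f : {rmorphism R -> complex R} := real_complex R.
pose A := adjmx R G.
have [z zA] := eigenvalue_closed (map_mx f A) G_gt0.
have Aherm : (map_mx Num.conj (map_mx f A)^T = map_mx f A)%R.
  apply/matrixP => i j; rewrite !mxE adj_sym.
  by case: (adj _ _); rewrite ?rmorph1 ?rmorph0.
have /eigenvalueP[v vA v_neq0] := zA.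
have [c c_neq0 cE] : exists2 c : complex R, (c != 0)%R &
    (v *m map_mx Num.conj v^T = c%:M)%R.
  exists ((v *m map_mx Num.conj v^T) 0 0)%R; last exact: mx11_scalar.
  rewrite mxE; apply: contraNneq v_neq0 => /eqP.
  rewrite psumr_eq0 => [/allP v0|i _]; last by rewrite !mxE mul_conjC_ge0.
  apply/eqP/rowP => i; rewrite [RHS]mxE.
  have := v0 i (mem_index_enum _); rewrite /= !mxE mulf_eq0 conjC_eq0 orbb.
  by move/eqP.
have : (v *m map_mx f A *m map_mx Num.conj v^T = z *: c%:M)%R.
  by rewrite vA -scalemxAl cE.
have : (v *m map_mx f A *m map_mx Num.conj v^T = z^* *: c%:M)%R.
  have := congr1 (fun M => map_mx Num.conj M^T)%R vA.
  rewrite trmx_mul map_mxM Aherm linearZ /= map_mxZ => vAc.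
  by rewrite -mulmxA vAc -scalemxAr cE.
move=> -> /matrixP/(_ ord0 ord0); rewrite !mxE eqxx !mulr1n.
move=> /(mulIf c_neq0) /CrealP zreal.
have zE : z = f (complex.Re z) by rewrite /= RRe_real.
by exists (complex.Re z); move: zA; rewrite [in X in X -> _]zE eigenvalue_map.
Qed.

Lemma spectral_radius_max (R : realType) (G : sgraph) : 0 < #|G| ->
  eigenvalue (adjmx R G) (spectral_radius R G) /\
  forall a : R, eigenvalue (adjmx R G) a -> (a <= spectral_radius R G)%R.
Proof.
move=> /(adjmx_eigenvalue R)[a0 a0A].
set E := [set a : R | eigenvalue (adjmx R G) a]%classic.
pose p := char_poly (adjmx R G).
have p_neq0 : (p != 0)%R by apply: monic_neq0; apply: char_poly_monic.
have EP a : E a <-> a \in rootsR p.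
  rewrite /E /= eigenvalue_root_char -/p; split.
    by move=> ap; rewrite -roots_on_rootsR.
  by rewrite -roots_on_rootsR.
have [m mE mub] : exists2 m, E m & forall a, E a -> (a <= m)%R.
  pose s := rootsR p; have a0s : a0 \in s by apply/EP.
  have [i _ imax] :=
    arg_maxP (fun i : seq_sub s => val i) (erefl : xpredT (SeqSub a0s)).
  exists (val i); first by apply/EP; apply: valP.
  by move=> a /EP a_s; apply: (imax (SeqSub a_s)).
have supE : spectral_radius R G = m.
  apply/eqP; rewrite eq_le; apply/andP; split.
    by apply: ge_sup; [exists m | exact: mub].
  by apply: ub_le_sup; [exists m; exact: mub | exact: mE].
by rewrite supE; split; [exact: mE | exact: mub].
Qed.

Inductive F1_vertex :=
  f_v13 | f_v23 | f_v1 | f_v2 | f_x | f_u1 | f_u2 | f_u3 | f_w13 | f_w23 | f_y.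

Definition F1_vertices : seq F1_vertex :=
  [:: f_v13; f_v23; f_v1; f_v2; f_x; f_u1; f_u2; f_u3; f_w13; f_w23; f_y].

Definition F1_code (a : F1_vertex) : nat :=
  match a with
  | f_v13 => 0 | f_v23 => 1 | f_v1 => 2 | f_v2 => 3 | f_x => 4 | f_u1 => 5
  | f_u2 => 6 | f_u3 => 7 | f_w13 => 8 | f_w23 => 9 | f_y => 10
  end.

Lemma F1_codeK : cancel F1_code (nth f_y F1_vertices).
Proof. by case. Qed.

HB.instance Definition _ := Countable.copy F1_vertex (can_type F1_codeK).

Lemma F1_vertices_enum : Finite.axiom F1_vertices.
Proof. by case. Qed.

HB.instance Definition _ := isFinite.Build F1_vertex F1_vertices_enum.

Definition F1_edges : seq (F1_vertex * F1_vertex) :=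
  [:: (f_y, f_v13); (f_y, f_v23); (f_y, f_v1); (f_y, f_v2); (f_y, f_x);
      (f_u1, f_u2); (f_u1, f_v13); (f_u1, f_v1); (f_u1, f_w13);
      (f_u2, f_v23); (f_u2, f_v2); (f_u2, f_w23);
      (f_u3, f_v13); (f_u3, f_v23); (f_u3, f_w13); (f_u3, f_w23);
      (f_x, f_w13); (f_x, f_w23);
      (f_v1, f_w23);
      (f_v2, f_w13)].

Definition F1_adj : rel F1_vertex :=
  fun a b => ((a, b) \in F1_edges) || ((b, a) \in F1_edges).

Lemma F1_sym : symmetric F1_adj.
Proof. by move=> a b; rewrite /F1_adj orbC. Qed.

Lemma F1_irr : irreflexive F1_adj.
Proof. by case. Qed.

Definition F1 : sgraph := SGraph F1_sym F1_irr.

(* Each vertex v is replaced with an independent set of size m v. *)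
Definition blow_up_adj (G : sgraph) (m : G -> nat) : rel {v : G & 'I_(m v)} :=
  fun a b => adj (tag a) (tag b).

Lemma blow_up_sym (G : sgraph) (m : G -> nat) : symmetric (@blow_up_adj G m).
Proof. by move=> a b; apply: adj_sym. Qed.

Lemma blow_up_irr (G : sgraph) (m : G -> nat) : irreflexive (@blow_up_adj G m).
Proof. by move=> a; apply: adj_irr. Qed.

Definition blow_up (G : sgraph) (m : G -> nat) : sgraph :=
  SGraph (@blow_up_sym G m) (@blow_up_irr G m).

Definition F1_mult (s t : nat) (v : F1) : nat :=
  match v with f_x => s | f_y => t | _ => 1 end.

Definition F1_blow_up (s t : nat) : sgraph := blow_up (F1_mult s t).

(* Main.v *)
From HB Require Import structures.
Require Import Defs.
From mathcomp Require Import all_boot all_order all_algebra.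
From mathcomp Require Import sesquilinear spectral complex.
From mathcomp Require Import reals.
From mathcomp Require Import ring lra zify.

(** Write N = n - 3 and M = floor(N^2 / 4), and call F the blow-up of the
    theorem.  It is enough to show that a triangle-free graph G on n vertices
    with chromatic number at least 4 and rho(G) >= rho(F) is isomorphic to F.

    Shape of G.  Let x >= 0 be an eigenvector for rho = rho(G) with largest
    entry x(v0) = 1, let A be the neighbourhood of v0 and B its complement.
    Using the eigenvalue equation at v0 and then at its neighbours gives
    rho^2 = sum over w in B of d_A(w) x(w).  As G is triangle-free, A is
    independent, and so are the neighbours in B of any vertex a of A.  But a
    graph that becomes bipartite after the deletion of two vertices and has no
    triangle is 3-colourable ([three_outside]): hence every a misses at least
    three vertices of B, and rho^2 <= |A| (|B| - 3) <= M.  On the other hand a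
    test vector gives rho(F)^2 >= M - 49/4, so all of these inequalities are
    tight up to a bounded error.  In particular d_A(w) (1 - x(w)) is bounded,
    while rho x(w) is at most d_A(w) plus a constant; together these force
    d_A(w) to be either bounded or within a constant of rho.  Exactly three
    vertices u1, u2, u3 of B have bounded degree into A, and the set H of the
    others is independent: G is bipartite up to three vertices
    ([stability]).

    Counting nonedges.  Let m be the number of nonadjacent pairs in A x H.
    Trying out a few explicit 3-colourings shows that, of the u's, exactly
    u1 and u2 are adjacent, that on each side u3 has common neighbours with u1
    and with u2, and that there are further neighbours of u1 or u2 on the sides.
    All of these create nonedges, because G is triangle-free; there are at least
    six of them, and exactly six only if G is a blow-up of the Groetzsch
    graph, with A or H as the side containing the copies of x
    ([six_nonedges]).

    Counting walks.  A nonedge at w in H is paid for twice, once in d_A(w) and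
    once in x(w), whereas u1, u2, u3 contribute O(1/rho); so
    rho^2 < |A||H| - 2m + 3/4 ([rho2_upper]).  Since rho^2 >= M - 49/4,
    |A||H| <= M and m >= 6, this forces |A||H| = M and m = 6.

    Which side is larger.  If N is odd this leaves two blow-ups, which agree
    to first order.  Both are compared exactly: eliminating the nine
    unreplaced vertices from the eigenvalue equations leaves a 2 x 2 system in
    the weights of the two blown-up classes, and the difference of the two
    determinants is a polynomial in the eigenvalue alone, which is negative
    ([F1_sides_compare]). *)

Set Implicit Arguments.
Unset Strict Implicit.
Unset Printing Implicit Defensive.

(** * Colourings of triangle-free graphs that are nearly bipartite *)

Definition independent (G : sgraph) (S : {set G}) : Prop :=
  {in S &, forall a b, adj a b = false}.

Lemma triangle_freeP (G : sgraph) : triangle_free G ->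
  forall a b c : G, adj a b -> adj b c -> adj a c = false.
Proof.
move=> Gtf a b c ab bc; apply/negP => ac; apply: Gtf.
pose f (i : complete 3) : G := nth a [:: a; b; c] (val i).
have fadj : {homo f : i j / adj i j}.
  move=> [i i3] [j j3]; rewrite /= /f /= => /eqP ij.
  move: i j i3 j3 ij => [|[|[|i]]] [|[|[|j]]] //= i3 j3 ij;
    by [rewrite // adj_sym | case: ij; apply: val_inj].
exists f => // i j fij; apply/eqP; apply: contraT => ij.
by have := fadj i j ij; rewrite fij adj_irr.
Qed.

Lemma no_three_cover (G : sgraph) (C0 C1 C2 : {set G}) :
    4 <= chromatic_number G ->
    independent C0 -> independent C1 -> independent C2 ->
  ~ (forall v : G, [\/ v \in C0, v \in C1 | v \in C2]).
Proof.
move=> chi4 iC0 iC1 iC2 cover.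
suff col3 : colorable G 3.
  by move: chi4; rewrite /chromatic_number; case: ex_minnP => k _ /(_ 3 col3); lia.
pose c v : 'I_3 := if v \in C0 then 0%R else if v \in C1 then 1%R else 2%R.
apply/existsP; exists [ffun v => c v].
apply/forallP => a; apply/forallP => b; apply/implyP => ab; rewrite !ffunE.
have iC i C x y (iCC : independent C) : adj x y -> x \in C -> y \in C -> i = true.
  by move=> xy xC yC; rewrite iCC in xy.
rewrite /c; case: (boolP (a \in C0)) => a0; case: (boolP (b \in C0)) => b0.
- exact: iC iC0 ab a0 b0.
- by case: ifP.
- by case: ifP.
case: (boolP (a \in C1)) => a1; case: (boolP (b \in C1)) => b1 //.
  exact: iC iC1 ab a1 b1.
apply: iC iC2 ab _ _.
  by case: (cover a) => // aC; rewrite aC in a0 a1.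
by case: (cover b) => // bC; rewrite bC in b0 b1.
Qed.

Section NotThreeColorable.
Variable G : sgraph.
Hypotheses (Gtf : triangle_free G) (chi4 : 4 <= chromatic_number G).
Implicit Types (A B : {set G}) (u v w a b : G).

Let tf a b c : adj a b -> adj b c -> adj a c = false.
Proof. exact: triangle_freeP. Qed.

(** Colour the neighbours of u with one colour, which is proper without
   triangles; then u is isolated in what remains and may join the side A. *)
Lemma no_star_cover u A B : independent A -> independent B ->
  ~ (forall v, [|| v \in A, v \in B, adj u v | v == u]).
Proof.
move=> iA iB cover.
apply: (@no_three_cover G [set v | adj u v]
         [set v | (v \in A) && ~~ adj u v || (v == u)] B) => //.
- by move=> a b; rewrite !inE => ua ub; apply: tf ub; rewrite adj_sym.
- move=> a b; rewrite !inE => /orP[/andP[aA ua]|/eqP->] /orP[/andP[bA ub]|/eqP->].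
  + exact: iA.
  + by rewrite adj_sym (negPf ua).
  + by rewrite (negPf ub).
  + exact: adj_irr.
- move=> v; have := cover v; rewrite !inE; case/or4P => [vA|vB|->|->].
  + by rewrite vA /=; case: (adj u v); [constructor 1|constructor 2].
  + by constructor 3.
  + by constructor 1.
  + by constructor 2; rewrite orbT.
Qed.

(** Two exceptional vertices can be given the third colour if they are not
   adjacent; if they are, one of them is a star centre covering the other. *)
Lemma three_outside A B : independent A -> independent B ->
  2 < #|~: (A :|: B)|.
Proof.
move=> iA iB; set W := ~: _; rewrite ltnNge; apply/negP => W2.
have Wi : independent W.
  move=> u w uW wW; apply/negP => uw.
  have neq_uw : u != w by apply: contraTneq uw => ->; rewrite adj_irr.
  have WE : W = [set u; w].
    apply/esym/eqP; rewrite eqEcard cards2 neq_uw W2 andbT.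
    by apply/subsetP => z; rewrite !inE => /orP[]/eqP->; move: uW wW; rewrite !inE.
  apply: (@no_star_cover u A B iA iB) => v.
  have : v \in A :|: B :|: W by rewrite /W setUCr inE.
  rewrite WE !inE => /or3P[/orP[]->|->|/eqP->]; rewrite ?orbT //.
  by rewrite uw !orbT.
apply: (@no_three_cover G A B W chi4) => // v.
have : v \in A :|: B :|: W by rewrite /W setUCr inE.
by rewrite !in_setU => /orP[/orP[]|] ?; [constructor 1|constructor 2|constructor 3].
Qed.

(** The adjacencies prescribed among the three exceptional vertices are the only
   ones possible up to order, by [bbt_exists]. *)
Record bipartite_but_three A B u1 u2 u3 : Prop := BipartiteButThree {
  bbt_A : independent A;
  bbt_B : independent B;
  bbt_AB : [disjoint A & B];
  bbt_out : ~: (A :|: B) = [set u1; u2; u3];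
  bbt_12 : adj u1 u2;
  bbt_13 : adj u1 u3 = false;
  bbt_23 : adj u2 u3 = false }.

Lemma bbt_swap_sides A B u1 u2 u3 :
  bipartite_but_three A B u1 u2 u3 -> bipartite_but_three B A u1 u2 u3.
Proof. by case=> *; split; rewrite // 1?disjoint_sym 1?setUC. Qed.

Lemma bbt_swap_ends A B u1 u2 u3 :
  bipartite_but_three A B u1 u2 u3 -> bipartite_but_three A B u2 u1 u3.
Proof.
by case=> ? ? ? out ? ? ?; split; rewrite // 1?adj_sym // out (setUC [set u1]).
Qed.

(** With no edge among the exceptional vertices they form a third colour class;
   a vertex adjacent to the two others is excluded by [no_star_cover].  Hence
   there is exactly one edge. *)
Lemma bbt_exists A B : independent A -> independent B -> [disjoint A & B] ->
  #|~: (A :|: B)| = 3 -> exists u1 u2 u3, bipartite_but_three A B u1 u2 u3.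
Proof.
move=> iA iB dAB; set W := ~: _ => W3.
have cover v : v \in A :|: B :|: W by rewrite /W setUCr inE.
have [u [w [uW wW uw]]] : exists u w, [/\ u \in W, w \in W & adj u w].
  have [/exists_inP[u uW /exists_inP[w wW uw]]|] :=
    boolP [exists u in W, [exists w in W, adj u w]]; first by exists u, w.
  rewrite negb_exists => /forallP Wn; case: (@no_three_cover G A B W chi4) => //.
    move=> u w uW wW; apply/negP => uw; have := Wn u; rewrite uW /= => /exists_inP[].
    by exists w.
  move=> v; move: (cover v); rewrite !in_setU.
  by move=> /orP[/orP[]|] ?; [constructor 1|constructor 2|constructor 3].
have neq_uw : u != w by apply: contraTneq uw => ->; rewrite adj_irr.
have uwW : [set u; w] \subset W.
  by apply/subsetP => z; rewrite !in_set2 => /orP[]/eqP->.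
have /cards1P[t tE] : #|W :\: [set u; w]| == 1.
  by rewrite cardsD (setIidPr uwW) cards2 neq_uw W3.
have WE : W = [set u; w; t].
  by rewrite -tE setDE setUIr setUCr setIT; apply/esym/setUidPr.
have star z : (forall v, v \in W -> adj z v || (v == z)) -> False.
  move=> zW; apply: (@no_star_cover z A B iA iB) => v.
  move: (cover v); rewrite !in_setU => /orP[/orP[]->|/zW]; rewrite ?orbT //.
  by move->; rewrite !orbT.
have ut : adj u t = false.
  apply/negP => ut; apply: (star u) => v.
  by rewrite WE !inE -orbA => /or3P[]/eqP->; rewrite ?eqxx ?uw ?ut ?orbT.
have wt : adj w t = false.
  apply/negP => wt; apply: (star w) => v.
  by rewrite WE !inE -orbA => /or3P[]/eqP->; rewrite ?eqxx ?(adj_sym w u) ?uw ?wt ?orbT.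
by exists u, w, t; split.
Qed.

Section Config.
Variables (A B : {set G}) (u1 u2 u3 : G).
Hypothesis bbt : bipartite_but_three A B u1 u2 u3.

Let iA : independent A. Proof. by case: bbt. Qed.
Let iB : independent B. Proof. by case: bbt. Qed.
Let u12 : adj u1 u2. Proof. by case: bbt. Qed.
Let u21 : adj u2 u1. Proof. by rewrite adj_sym. Qed.
Let u13 : adj u1 u3 = false. Proof. by case: bbt. Qed.
Let u23 : adj u2 u3 = false. Proof. by case: bbt. Qed.

Lemma bbt_cover v : [|| v \in A, v \in B, v == u1, v == u2 | v == u3].
Proof.
case: bbt => _ _ _ out _ _ _; have : v \in A :|: B :|: ~: (A :|: B).
  by rewrite setUCr inE.
by rewrite out !inE -!orbA.
Qed.

(** Otherwise colour B with 1, A minus N(u2) together with u2 with 0, and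
   the neighbours of u2 in A together with u1 and u3 with 2.  Exchanging the sides
   or the ends u1, u2 gives four such vertices. *)
Lemma common_neighbour : exists v, [/\ v \in A, adj u2 v & adj u3 v].
Proof.
suff /exists_inP[v vA /andP[? ?]] : [exists v in A, adj u2 v && adj u3 v].
  by exists v.
apply: contraT; rewrite negb_exists => /forallP none; exfalso.
have {}none v : v \in A -> adj u2 v -> adj u3 v = false.
  by move=> vA u2v; have := none v; rewrite vA u2v /= => /negPf.
apply: (@no_three_cover G [set v | (v \in A) && ~~ adj u2 v || (v == u2)] B
         [set v | (v \in A) && adj u2 v || (v == u1) || (v == u3)]) => //.
- move=> a b; rewrite !inE => /orP[/andP[aA ua]|/eqP->] /orP[/andP[bA ub]|/eqP->].
  + exact: iA.
  + by rewrite adj_sym (negPf ua).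
  + by rewrite (negPf ub).
  + exact: adj_irr.
- have u1A a : adj u2 a -> adj u1 a = false by move=> u2a; apply: tf u2a.
  move=> a b; rewrite !inE -!orbA.
  move=> /or3P[/andP[aA ua]|/eqP->|/eqP->] /or3P[/andP[bA ub]|/eqP->|/eqP->].
  + exact: iA.
  + by rewrite adj_sym u1A.
  + by rewrite adj_sym none.
  + exact: u1A.
  + exact: adj_irr.
  + exact: u13.
  + exact: none.
  + by rewrite adj_sym.
  + exact: adj_irr.
move=> v; have := bbt_cover v; rewrite !inE.
case/or4P => [vA|vB|->|/orP[]->].
- by rewrite vA /=; case: (adj u2 v); [constructor 3|constructor 1].
- by constructor 2.
- by constructor 3; rewrite orbT.
- by constructor 1; rewrite orbT.
- by constructor 3; rewrite !orbT.
Qed.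

(** If there is no such edge, the neighbours of u2 in A and the neighbours of u1
   or u3 in B form an independent set.  The rest of A can be coloured together
   with u2, and the rest of B together with u1 and u3. *)
Lemma linking_edge : exists a b,
  [/\ a \in A, b \in B, adj a b, adj u2 a & adj u1 b || adj u3 b].
Proof.
suff /exists_inP[a aA /exists_inP[b bB /and3P[? ? ?]]] :
    [exists a in A, [exists b in B,
      [&& adj a b, adj u2 a & adj u1 b || adj u3 b]]].
  by exists a, b.
apply: contraT; rewrite negb_exists => /forallP none; exfalso.
have {}none a b : a \in A -> b \in B -> adj u2 a -> adj u1 b || adj u3 b ->
    adj a b = false.
  move=> aA bB u2a ub; have := none a; rewrite aA negb_exists => /forallP/(_ b).
  by rewrite bB u2a ub !andbT => /negPf.
apply: (@no_three_cover G [set v | (v \in A) && ~~ adj u2 v || (v == u2)]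
  [set v | (v \in A) && adj u2 v || (v \in B) && (adj u1 v || adj u3 v)]
  [set v | [|| (v \in B) && ~~ (adj u1 v || adj u3 v), v == u1 | v == u3]]) => //.
- move=> a b; rewrite !inE => /orP[/andP[aA ua]|/eqP->] /orP[/andP[bA ub]|/eqP->].
  + exact: iA.
  + by rewrite adj_sym (negPf ua).
  + by rewrite (negPf ub).
  + exact: adj_irr.
- move=> a b; rewrite !inE.
  move=> /orP[]/andP[aS ua] /orP[]/andP[bS ub].
  + exact: iA.
  + exact: none.
  + by rewrite adj_sym none.
  + exact: iB.
- move=> a b; rewrite !inE !negb_or.
  move=> /or3P[/and3P[aB /negPf ua1 /negPf ua3]|/eqP->|/eqP->];
  move=> /or3P[/and3P[bB /negPf ub1 /negPf ub3]|/eqP->|/eqP->];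
  by rewrite ?adj_irr ?ub1 ?ub3 ?u13 ?(iB aB bB) // adj_sym ?ua1 ?ua3 ?u13.
move=> v; have := bbt_cover v; rewrite !inE.
case/or4P => [vA|vB|->|/orP[]->].
- by rewrite vA /=; case: (adj u2 v); [constructor 2|constructor 1].
- by rewrite vB /=; case: (_ || adj u3 v); [constructor 2; rewrite orbT|constructor 3].
- by constructor 3; rewrite orbT.
- by constructor 1; rewrite orbT.
- by constructor 3; rewrite !orbT.
Qed.

End Config.
End NotThreeColorable.

(** * Nonedges between the two sides *)

(** The vertex v is sent to the copy of h v numbered by its position in the
   fibre of h through v. *)
Lemma blow_up_characterization (G H : sgraph) (m : H -> nat) (h : G -> H) :
    (forall v w, adj v w = adj (h v) (h w)) ->
    (forall i, #|[set v | h v == i]| = m i) ->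
  isomorphic G (blow_up m).
Proof.
move=> hadj hm; pose e v := enum [set w | h w == h v].
have lt_e v : index v (e v) < m (h v).
  by rewrite -hm cardE index_mem mem_enum inE.
pose f v : blow_up m := existT _ (h v) (Ordinal (lt_e v)).
have f_inj : injective f.
  move=> v w fvw; pose code (z : blow_up m) := (tag z, val (tagged z)).
  have [hvw] := congr1 code fvw; rewrite /e hvw => ivw.
  have mem z : h z = h w -> z \in enum [set z | h z == h w].
    by move=> hz; rewrite mem_enum inE hz.
  by rewrite -(nth_index v (mem v hvw)) ivw nth_index ?mem.
exists f; last by move=> v w; rewrite /= /blow_up_adj /= -hadj.
apply: (inj_card_bij f_inj); rewrite card_tagged sumnE big_map big_enum /=.
rewrite (eq_bigr (fun i => \sum_(v | h v == i) 1)); last first.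
  by move=> i _; rewrite card_ord -hm -sum1_card; apply: eq_bigl => v; rewrite inE.
by rewrite -sum1_card (partition_big h xpredT).
Qed.

Definition nonedges (G : sgraph) (A B : {set G}) : {set G * G} :=
  [set p | [&& p.1 \in A, p.2 \in B & ~~ adj p.1 p.2]].

Lemma card_nonedges_swap (G : sgraph) (A B : {set G}) :
  #|nonedges A B| = #|nonedges B A|.
Proof.
(* Reversing pairs exchanges the two sets of nonedges. *)
pose sw (p : G * G) := (p.2, p.1).
have sw_inj : injective sw by move=> [a b] [a' b'] [-> ->].
rewrite -(card_imset _ sw_inj).
apply: eq_card => -[b a]; apply/imsetP/idP => [[[a' b']]|].
  by rewrite !inE /= => /and3P[? ? ?] [-> ->]; apply/and3P; split; rewrite // adj_sym.
rewrite !inE /= => /and3P[? ? ?]; exists (a, b) => //.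
by rewrite !inE /=; apply/and3P; split; rewrite // adj_sym.
Qed.

Section Anchors.
Variable G : sgraph.
Hypothesis Gtf : triangle_free G.

Let tf (a b c : G) : adj a b -> adj b c -> adj a c = false.
Proof. exact: triangle_freeP. Qed.

Lemma independent_neq (u a b : G) : adj u a -> adj u b = false -> a != b.
Proof. by move=> ua; apply: contraFneq => <-. Qed.

Lemma nonadj_common (u a b : G) : adj u a -> adj u b -> adj a b = false.
Proof. by move=> ua; apply: tf; rewrite adj_sym. Qed.

(** The four common neighbours given by [common_neighbour]; they account for four
   nonedges, because u3 is adjacent to all of them. *)
Record anchored (A B : {set G}) (u1 u2 u3 v13 v23 w13 w23 : G) : Prop :=
  Anchored {
  anc_bbt : bipartite_but_three A B u1 u2 u3;
  anc_v13 : [/\ v13 \in A, adj u1 v13 & adj u3 v13];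
  anc_v23 : [/\ v23 \in A, adj u2 v23 & adj u3 v23];
  anc_w13 : [/\ w13 \in B, adj u1 w13 & adj u3 w13];
  anc_w23 : [/\ w23 \in B, adj u2 w23 & adj u3 w23] }.

Lemma anchored_exist A B u1 u2 u3 :
    4 <= chromatic_number G -> bipartite_but_three A B u1 u2 u3 ->
  exists v13 v23 w13 w23, anchored A B u1 u2 u3 v13 v23 w13 w23.
Proof.
move=> chi4 bbt.
have [v23 v23P] := common_neighbour Gtf chi4 bbt.
have [v13 v13P] := common_neighbour Gtf chi4 (bbt_swap_ends bbt).
have [w23 w23P] := common_neighbour Gtf chi4 (bbt_swap_sides bbt).
have [w13 w13P] :=
  common_neighbour Gtf chi4 (bbt_swap_ends (bbt_swap_sides bbt)).
by exists v13, v23, w13, w23.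
Qed.

Lemma anchored_swap_sides A B u1 u2 u3 v13 v23 w13 w23 :
  anchored A B u1 u2 u3 v13 v23 w13 w23 ->
  anchored B A u1 u2 u3 w13 w23 v13 v23.
Proof. by case=> /bbt_swap_sides *; split. Qed.

Lemma anchored_swap_ends A B u1 u2 u3 v13 v23 w13 w23 :
  anchored A B u1 u2 u3 v13 v23 w13 w23 ->
  anchored A B u2 u1 u3 v23 v13 w23 w13.
Proof. by case=> /bbt_swap_ends *; split. Qed.

Lemma anchored_neq A B u1 u2 u3 v13 v23 w13 w23 :
  anchored A B u1 u2 u3 v13 v23 w13 w23 -> v13 != v23 /\ w13 != w23.
Proof.
case=> -[_ _ _ _ u12 _ _] [_ u1v _] [_ u2v _] [_ u1w _] [_ u2w _].
split; [apply: (independent_neq u1v)|apply: (independent_neq u1w)];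
  exact: tf u12 _.
Qed.

(** When the two additional neighbours lie on different sides they have a common
   neighbour, so that the pair they form is a seventh nonedge. *)
Lemma mixed_seven_nonedges A B u1 u2 u3 v13 v23 w13 w23 a b :
    anchored A B u1 u2 u3 v13 v23 w13 w23 ->
    a \in A -> adj u1 a -> adj u3 a = false ->
    b \in B -> adj u1 b -> adj u3 b = false ->
  6 < #|nonedges A B|.
Proof.
move=> anc aA u1a u3a bB u1b u3b; have [neq_v neq_w] := anchored_neq anc.
case: anc => _ [v1A u1v u3v] [v2A u2v u3v2] [w1B u1w u3w] [w2B u2w u3w2].
pose s := [:: (v13, w13); (v13, w23); (v23, w13); (v23, w23);
              (a, w13); (v13, b); (a, b)].
have neq (v z : G) : adj u3 v -> adj u3 z = false -> (z == v) = false /\ (v == z) = false.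
  move=> u3v' u3z; rewrite [z == v]eq_sym; suff -> : (v == z) = false by [].
  exact: negbTE (independent_neq u3v' u3z).
have [[a1 a2] [b1 b2]] : ((a == v13) = false /\ (a == v23) = false)
   /\ ((b == w13) = false /\ (b == w23) = false).
  by split; split; [case: (neq v13 a)|case: (neq v23 a)|case: (neq w13 b)|case: (neq w23 b)].
have us : uniq s.
  rewrite /s /= !inE !xpair_eqE (negPf neq_v) (negPf neq_w) !eqxx.
  rewrite ?[_ == a]eq_sym ?[_ == b]eq_sym ?a1 ?a2 ?b1 ?b2.
  by rewrite ?[v23 == _]eq_sym ?(negPf neq_v) ?andbF.
have sub : {subset s <= enum (nonedges A B)}.
  apply/allP; rewrite /s /= !mem_enum !inE /= v1A v2A w1B w2B aA bB /=.
  by rewrite (nonadj_common u1a u1w) (nonadj_common u1a u1b)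
       (nonadj_common u1v u1b) !(nonadj_common u3v) ?(nonadj_common u3v2).
by have := uniq_leq_size us sub; rewrite -cardE.
Qed.

(** Here both additional neighbours a1 of u1 and a2 of u2 lie on the side A;
   they play the parts of the vertices v1 and v2 of the Groetzsch graph. *)
Section Six.
Variables (A B : {set G}) (u1 u2 u3 v13 v23 w13 w23 a1 a2 : G).
Hypothesis anc : anchored A B u1 u2 u3 v13 v23 w13 w23.
Hypotheses (a1A : a1 \in A) (u1a1 : adj u1 a1) (u3a1 : adj u3 a1 = false).
Hypotheses (a2A : a2 \in A) (u2a2 : adj u2 a2) (u3a2 : adj u3 a2 = false).

Let six : seq (G * G) :=
  [:: (v13, w13); (v13, w23); (v23, w13); (v23, w23); (a1, w13); (a2, w23)].

Lemma six_uniq : uniq six.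
Proof.
have [neq_v neq_w] := anchored_neq anc.
have [_ [v1A u1v u3v] [v2A u2v u3v2] _ _] := anc.
have n v z : adj u3 v -> adj u3 z = false -> (v == z) = false.
  by move=> uv uz; apply: negbTE (independent_neq uv uz).
rewrite /six /= !inE !xpair_eqE !eqxx (negPf neq_v) (negPf neq_w).
by rewrite !(n v13 _ u3v) ?(n v23 _ u3v2) ?andbF.
Qed.

Lemma six_sub : {subset six <= enum (nonedges A B)}.
Proof.
have [_ [v1A u1v u3v] [v2A u2v u3v2] [w1B u1w u3w] [w2B u2w u3w2]] := anc.
apply/allP; rewrite /six /= !mem_enum !inE /= v1A v2A w1B w2B a1A a2A /=.
by rewrite (nonadj_common u1a1 u1w) (nonadj_common u2a2 u2w)
     !(nonadj_common u3v) ?(nonadj_common u3v2).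
Qed.

Lemma six_le_nonedges : 6 <= #|nonedges A B|.
Proof. by have := uniq_leq_size six_uniq six_sub; rewrite -cardE. Qed.

Hypothesis six_edges : #|nonedges A B| = 6.

(** With only six nonedges, the six known ones are all of them, and the whole
   graph is determined. *)
Lemma nonedgeE a b : a \in A -> b \in B -> adj a b = ((a, b) \notin six).
Proof.
move=> aA bB.
have -> : ((a, b) \in six) = ((a, b) \in enum (nonedges A B)).
  have [|_ ->] // := uniq_min_size six_uniq six_sub.
  by rewrite -cardE six_edges.
by rewrite mem_enum inE aA bB negbK.
Qed.

Let hA v : F1 :=
  if v == v13 then f_v13 else if v == v23 then f_v23 else
  if v == a1 then f_v1 else if v == a2 then f_v2 else f_x.
Let hB w : F1 := if w == w13 then f_w13 else if w == w23 then f_w23 else f_y.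
Let h v : F1 := if v \in A then hA v else if v \in B then hB v else
  if v == u1 then f_u1 else if v == u2 then f_u2 else f_u3.

(** Every neighbour of a u on one side forms a nonedge with an anchor of the
   other side, so it occurs in the list of six: this determines the
   neighbourhoods of the u's. *)
Lemma six_isomorphic : isomorphic G (F1_blow_up (#|A| - 4) (#|B| - 2)).
Proof.
have [neq_v /negbTE neq_w] := anchored_neq anc.
have [bbt [v1A u1v u3v] [v2A u2v u3v2] [w1B u1w u3w] [w2B u2w u3w2]] := anc.
have [iA iB dAB out u12 u13 u23] := bbt.
have u21 : adj u2 u1 by rewrite adj_sym.
have AB z : z \in A -> z \in B = false by move=> zA; apply: (disjointFr dAB).
have BA z : z \in B -> z \in A = false by move=> zB; apply: (disjointFl dAB).
have outP u : u \in [:: u1; u2; u3] -> (u \in A) = false /\ (u \in B) = false.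
  move=> uW; have : u \in ~: (A :|: B) by rewrite out !inE -orbA; move: uW; rewrite !inE.
  by rewrite !inE negb_or => /andP[/negbTE-> /negbTE->].
have [[u1A u1B] [u2A u2B] [u3A u3B]] :
    [/\ (u1 \in A) = false /\ (u1 \in B) = false,
        (u2 \in A) = false /\ (u2 \in B) = false &
        (u3 \in A) = false /\ (u3 \in B) = false].
  by split; apply: outP; rewrite !inE eqxx ?orbT.
have n (u a b : G) : adj u a -> adj u b = false -> (a == b) = false /\ (b == a) = false.
  by move=> ua ub; rewrite [b == a]eq_sym (negbTE (independent_neq ua ub)).
have [_ u12n] : (u2 == u1) = false /\ (u1 == u2) = false.
  by apply: (n u1); rewrite ?adj_irr.
have u1n z : adj u2 z -> adj u1 z = false by apply: triangle_freeP.
have u2n z : adj u1 z -> adj u2 z = false by apply: triangle_freeP.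
have [_ u13n] : (u2 == u3) = false /\ (u1 == u3) = false.
  by split; [case: (n u1 u2 u3)|case: (n u2 u1 u3)].
have [u23n _] : (u2 == u3) = false /\ (u3 == u2) = false by apply: (n u1).
have [v12 v21] : (v13 == v23) = false /\ (v23 == v13) = false.
  by apply: (n u1) => //; apply: u1n.
have [v1a1 a1v1] := n _ _ _ u3v u3a1.
have [v1a2 a2v1] := n _ _ _ u3v u3a2.
have [v2a1 a1v2] := n _ _ _ u3v2 u3a1.
have [v2a2 a2v2] := n _ _ _ u3v2 u3a2.
have [a12 a21] : (a1 == a2) = false /\ (a2 == a1) = false.
  by apply: (n u1) => //; apply: u1n.
have w21 : (w23 == w13) = false by rewrite eq_sym.
pose neqs := (v12, v21, v1a1, a1v1, v1a2, a2v1, v2a1, a1v2, v2a2, a2v2, a12,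
  a21, neq_w, w21, u12n, u13n, u23n).
have adj1A v : v \in A -> adj u1 v = (v == v13) || (v == a1).
  move=> vA; apply/idP/idP => [u1z|/orP[]/eqP-> //].
  have := nonedgeE vA w1B; rewrite (nonadj_common u1z u1w) => /esym/negbFE.
  rewrite !inE !xpair_eqE !eqxx ?neq_w ?andbT ?andbF ?orbF /=.
  by case/or3P => [->|/eqP zE|->]; rewrite ?orbT //; move: u1z; rewrite zE u1n.
have adj2A v : v \in A -> adj u2 v = (v == v23) || (v == a2).
  move=> vA; apply/idP/idP => [u2z|/orP[]/eqP-> //].
  have := nonedgeE vA w2B; rewrite (nonadj_common u2z u2w) => /esym/negbFE.
  rewrite !inE !xpair_eqE !eqxx ?w21 ?andbT ?andbF ?orbF /=.
  by case/or3P => [/eqP zE|->|->]; rewrite ?orbT //; move: u2z; rewrite zE u2n.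
have adj3A v : v \in A -> adj u3 v = (v == v13) || (v == v23).
  move=> vA; apply/idP/idP => [u3z|/orP[]/eqP-> //].
  have := nonedgeE vA w1B; rewrite (nonadj_common u3z u3w) => /esym/negbFE.
  rewrite !inE !xpair_eqE !eqxx ?neq_w ?andbT ?andbF ?orbF /=.
  by case/or3P => [->|->|/eqP zE]; rewrite ?orbT //; move: u3z; rewrite zE u3a1.
have v13B w : w \in B -> adj v13 w = false -> (w == w13) || (w == w23).
  move=> wB vw; have := nonedgeE v1A wB; rewrite vw => /esym/negbFE.
  by rewrite !inE !xpair_eqE !eqxx !neqs /= ?orbF.
have adj1B w : w \in B -> adj u1 w = (w == w13).
  move=> wB; apply/idP/eqP => [u1z|-> //].
  case/orP: (v13B w wB (nonadj_common u1v u1z)) => /eqP // zE.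
  by move: u1z; rewrite zE u1n.
have adj2B w : w \in B -> adj u2 w = (w == w23).
  move=> wB; apply/idP/eqP => [u2z|-> //].
  have := nonedgeE v2A wB; rewrite (nonadj_common u2v u2z) => /esym/negbFE.
  rewrite !inE !xpair_eqE !eqxx !neqs /= ?orbF => /orP[]/eqP // zE.
  by move: u2z; rewrite zE u2n.
have adj3B w : w \in B -> adj u3 w = (w == w13) || (w == w23).
  move=> wB; apply/idP/idP => [u3z|/orP[]/eqP-> //].
  exact: v13B (nonadj_common u3v u3z).
have hAE v : v \in A -> h v = hA v by rewrite /h => ->.
have hBE v : v \in B -> h v = hB v by move=> vB; rewrite /h BA // vB.
have h1 : h u1 = f_u1 by rewrite /h u1A u1B eqxx.
have h2 : h u2 = f_u2 by rewrite /h u2A u2B eq_sym u12n eqxx.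
have h3 : h u3 = f_u3.
  by rewrite /h u3A u3B eq_sym u13n eq_sym u23n.
have cover := bbt_cover bbt.
have hadjA v w : v \in A -> adj v w = adj (h v) (h w).
  move=> vA; rewrite (hAE v) // /hA.
  case/or4P: (cover w) => [wA|wB|/eqP->|/orP[]/eqP->].
  - by rewrite iA // hAE // /hA; do !case: ifP.
  - rewrite nonedgeE // hBE // /hB !inE !xpair_eqE.
    case: (v =P v13) => [E|_]; last case: (v =P v23) => [E|_];
      last case: (v =P a1) => [E|_]; last case: (v =P a2) => [E|_];
      rewrite ?E ?neqs ?eqxx /=;
      by case: (w =P w13) => [F|_]; last case: (w =P w23) => [F|_];
         rewrite ?F ?neqs ?eqxx.
  - rewrite adj_sym adj1A // h1.
    case: (v =P v13) => [E|_]; last case: (v =P v23) => [E|_];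
      last case: (v =P a1) => [E|_]; last case: (v =P a2) => [E|_];
      by rewrite ?E ?neqs ?eqxx.
  - rewrite adj_sym adj2A // h2.
    case: (v =P v13) => [E|_]; last case: (v =P v23) => [E|_];
      last case: (v =P a1) => [E|_]; last case: (v =P a2) => [E|_];
      by rewrite ?E ?neqs ?eqxx.
  - rewrite adj_sym adj3A // h3.
    case: (v =P v13) => [E|_]; last case: (v =P v23) => [E|_];
      last case: (v =P a1) => [E|_]; last case: (v =P a2) => [E|_];
      by rewrite ?E ?neqs ?eqxx.
have hadjB v w : v \in B -> adj v w = adj (h v) (h w).
  move=> vB; case/or4P: (cover w) => [wA|wB|/eqP->|/orP[]/eqP->].
  - by rewrite adj_sym hadjA // [RHS]adj_sym.
  - by rewrite iB // !hBE // /hB; do !case: ifP.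
  - rewrite adj_sym adj1B // h1 hBE // /hB.
    by case: (v =P w13) => [E|_]; last case: (v =P w23) => [E|_];
      rewrite ?E ?neqs ?eqxx.
  - rewrite adj_sym adj2B // h2 hBE // /hB.
    by case: (v =P w13) => [E|_]; last case: (v =P w23) => [E|_];
      rewrite ?E ?neqs ?eqxx.
  - rewrite adj_sym adj3B // h3 hBE // /hB.
    by case: (v =P w13) => [E|_]; last case: (v =P w23) => [E|_];
      rewrite ?E ?neqs ?eqxx.
have hadj v w : adj v w = adj (h v) (h w).
  case/or4P: (cover v) => [vA|vB|vu|vu]; [exact: hadjA|exact: hadjB|..];
    (case/or4P: (cover w) => [wA|wB|wu|wu];
      [by rewrite [LHS]adj_sym [RHS]adj_sym hadjA
      |by rewrite [LHS]adj_sym [RHS]adj_sym hadjB|..]).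
  - by rewrite (eqP vu) (eqP wu) h1 adj_irr.
  - by case/orP: wu => /eqP->; rewrite (eqP vu) h1 ?h2 ?h3 ?u12 ?u13.
  - by case/orP: vu => /eqP->; rewrite (eqP wu) h1 ?h2 ?h3 adj_sym ?u12 ?u13.
  - case/orP: vu => /eqP->; case/orP: wu => /eqP->;
      by rewrite ?h2 ?h3 ?adj_irr ?u23 // adj_sym u23.
apply: (@blow_up_characterization _ _ _ h hadj) => i.
pose S (i : F1) : {set G} := match i with
  | f_v13 => [set v13] | f_v23 => [set v23] | f_v1 => [set a1]
  | f_v2 => [set a2] | f_u1 => [set u1] | f_u2 => [set u2] | f_u3 => [set u3]
  | f_w13 => [set w13] | f_w23 => [set w23]
  | f_x => A :\: [set v13; v23; a1; a2] | f_y => B :\: [set w13; w23] end.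
have notin (C : {set G}) z z' : z \in C -> z' \in C = false -> (z == z') = false.
  by move=> zC; apply: contraFF => /eqP <-.
have w1A := BA _ w1B; have w2A := BA _ w2B.
have [v1B v2B a1B a2B] := And4 (AB _ v1A) (AB _ v2A) (AB _ a1A) (AB _ a2A).
have -> : [set v | h v == i] = S i.
  apply/setP => v; rewrite inE.
  case/or4P: (cover v) => [vA|vB|/eqP->|/orP[]/eqP->].
  - have vn z : z \in A = false -> (v == z) = false by apply: notin.
    rewrite hAE // /hA; case: i;
      rewrite /S /= ?in_setD ?in_setU ?in_set1 ?vA ?(AB v vA)
        ?(vn u1) ?(vn u2) ?(vn u3) ?(vn w13) ?(vn w23) ?andbF ?andbT //;
      (case: (v =P v13) => [E|_]; last case: (v =P v23) => [E|_];
      last case: (v =P a1) => [E|_]; last case: (v =P a2) => [E|_]);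
      by rewrite ?E ?neqs ?eqxx.
  - have vn z : z \in B = false -> (v == z) = false by apply: notin.
    rewrite hBE // /hB; case: i;
      rewrite /S /= ?in_setD ?in_setU ?in_set1 ?vB ?(BA v vB)
        ?(vn u1) ?(vn u2) ?(vn u3) ?(vn v13) ?(vn v23) ?(vn a1) ?(vn a2)
        ?andbF ?andbT //;
      (case: (v =P w13) => [E|_]; last case: (v =P w23) => [E|_]);
      by rewrite ?E ?neqs ?eqxx.
  all: have un u z (C : {set G}) : z \in C -> u \in C = false -> (u == z) = false
    by move=> zC uC; rewrite eq_sym (notin C z u zC uC).
  - rewrite h1; case: i; rewrite /S /= ?in_setD ?in_setU ?in_set1 ?u1A ?u1B
      ?(un u1 v13 A) ?(un u1 v23 A) ?(un u1 a1 A) ?(un u1 a2 A)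
      ?(un u1 w13 B) ?(un u1 w23 B) ?andbF ?neqs ?eqxx //.
  - rewrite h2; case: i; rewrite /S /= ?in_setD ?in_setU ?in_set1 ?u2A ?u2B
      ?(un u2 v13 A) ?(un u2 v23 A) ?(un u2 a1 A) ?(un u2 a2 A)
      ?(un u2 w13 B) ?(un u2 w23 B) ?andbF ?neqs ?[_ == u1]eq_sym ?[u3 == u2]eq_sym ?neqs ?eqxx //.
  - rewrite h3; case: i; rewrite /S /= ?in_setD ?in_setU ?in_set1 ?u3A ?u3B
      ?(un u3 v13 A) ?(un u3 v23 A) ?(un u3 a1 A) ?(un u3 a2 A)
      ?(un u3 w13 B) ?(un u3 w23 B) ?andbF ?neqs ?[_ == u1]eq_sym ?[u3 == u2]eq_sym ?neqs ?eqxx //.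
case: i; rewrite /S /F1_mult ?cards1 //; rewrite cardsD; congr subn.
  rewrite (setIidPr _).
    by rewrite -!setUA !cardsU1 !in_setU !in_set1 !neqs cards1.
  by apply/subsetP => z; rewrite !in_setU !in_set1 -!orbA => /or4P[]/eqP->.
rewrite (setIidPr _) ?cards2 ?neqs //.
by apply/subsetP => z; rewrite in_set2 => /orP[]/eqP->.
Qed.

End Six.

(** The end a of a linking edge is either not adjacent to u3, or it forces the
   other end b off u3, whence b is adjacent to u1. *)
Lemma linking_type (A B : {set G}) (u1 u2 u3 : G) :
    4 <= chromatic_number G -> bipartite_but_three A B u1 u2 u3 ->
  (exists2 a, a \in A & adj u2 a /\ adj u3 a = false) \/
  (exists2 b, b \in B & adj u1 b /\ adj u3 b = false).
Proof.
move=> chi4 bbt; have [a [b [aA bB ab u2a ub]]] := linking_edge chi4 bbt.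
have [u3a|/negbTE u3a] := boolP (adj u3 a); last by left; exists a.
have u3b : adj u3 b = false by apply: tf u3a ab.
by right; exists b => //; move: ub; rewrite u3b orbF.
Qed.

(** Besides the four nonedges among the anchors, each of the two linking edges
   provides a further neighbour of u1 or of u2, not adjacent to u3, and hence
   a nonedge with an anchor of the other side. *)
Theorem six_nonedges (A B : {set G}) (u1 u2 u3 : G) :
    4 <= chromatic_number G -> bipartite_but_three A B u1 u2 u3 ->
  6 <= #|nonedges A B| /\
  (#|nonedges A B| = 6 ->
     isomorphic G (F1_blow_up (#|A| - 4) (#|B| - 2)) \/
     isomorphic G (F1_blow_up (#|B| - 4) (#|A| - 2))).
Proof.
move=> chi4 bbt; have [v13 [v23 [w13 [w23 anc]]]] := anchored_exist chi4 bbt.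
have [[a2 a2A [u2a2 u3a2]]|[b1 b1B [u1b1 u3b1]]] := linking_type chi4 bbt;
have [[a1 a1A [u1a1 u3a1]]|[b2 b2B [u2b2 u3b2]]] :=
  linking_type chi4 (bbt_swap_ends bbt).
- split; first by apply: six_le_nonedges anc a1A u1a1 u3a1 a2A u2a2 u3a2.
  by move=> m6; left; apply: six_isomorphic anc a1A u1a1 u3a1 a2A u2a2 u3a2 m6.
- have := mixed_seven_nonedges (anchored_swap_ends anc) a2A u2a2 u3a2 b2B u2b2 u3b2.
  by move=> m7; split; [exact: ltnW|move=> m6; rewrite m6 in m7].
- have := mixed_seven_nonedges anc a1A u1a1 u3a1 b1B u1b1 u3b1.
  by move=> m7; split; [exact: ltnW|move=> m6; rewrite m6 in m7].
have {}anc := anchored_swap_sides anc; rewrite card_nonedges_swap.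
split; first by apply: six_le_nonedges anc b1B u1b1 u3b1 b2B u2b2 u3b2.
by move=> m6; right; apply: six_isomorphic anc b1B u1b1 u3b1 b2B u2b2 u3b2 m6.
Qed.

End Anchors.

(** * Blow-ups of the Groetzsch graph *)

Lemma index_F1 : index_enum F1 = F1_vertices.
Proof. by rewrite [index_enum _]unlock Finite.enum.unlock. Qed.

Lemma card_F1_blow_up s t : #|F1_blow_up s t| = s + t + 9.
Proof.
rewrite card_tagged sumnE big_map big_enum index_F1.
by rewrite !big_cons big_nil /= !card_ord; lia.
Qed.

Lemma blow_up_triangle_free (G : sgraph) (m : G -> nat) :
  (forall a b c : G, adj a b -> adj b c -> adj a c = false) ->
  triangle_free (blow_up m).
Proof.
move=> tf [f f_inj fadj].
pose i0 : complete 3 := (0%R : 'I_3); pose i1 : complete 3 := (1%R : 'I_3).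
pose i2 : complete 3 := (2%R : 'I_3).
by have := tf _ _ _ (fadj i0 i1 isT) (fadj i1 i2 isT); rewrite [adj _ _](fadj i0 i2 isT).
Qed.

Lemma F1_triangle_free (a b c : F1) : adj a b -> adj b c -> adj a c = false.
Proof. by case: a; case: b => //; case: c. Qed.

(** Mycielski's argument: the nonneighbours of y carry a 5-cycle, each of whose
   vertices has a twin among the neighbours of y.  Recolouring with the twin's
   colour wherever the colour of y occurs gives a proper colouring of the 5-cycle
   with two colours. *)
Lemma F1_not_3_colorable (c : F1 -> 'I_3) :
  exists a b : F1, adj a b /\ c a = c b.
Proof.
have [/existsP[a /existsP[b /andP[ab /eqP cab]]]|] :=
  boolP [exists a, [exists b, adj a b && (c a == c b)]]; first by exists a, b.
rewrite negb_exists => /forallP none; exfalso.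
have {}none (a b : F1) : adj a b -> c a != c b.
  by move=> ab; have := none a; rewrite negb_exists => /forallP/(_ b); rewrite ab.
pose d (a a' : F1) := if c a == c f_y then c a' else c a.
have dy a a' : adj (f_y : F1) a' -> d a a' != c f_y.
  by move=> ya'; rewrite /d; case: ifP => [_|->//]; rewrite eq_sym none.
have dd a a' b b' : adj a b -> adj a b' -> adj a' b -> d a a' != d b b'.
  move=> ab ab' a'b; rewrite /d.
  case: ifP => [/eqP ay|_]; case: ifP => [/eqP yb|_]; try exact: none.
  by have := none _ _ ab; rewrite ay yb eqxx.
have two (p q r s t z : 'I_3) : p != z -> q != z -> r != z -> s != z -> t != z ->
   p != q -> q != r -> r != s -> s != t -> t != p -> False.
  by move: p q r s t z => [[|[|[|p]]] ?] [[|[|[|q]]] ?] // [[|[|[|r]]] ?] //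
     [[|[|[|s]]] ?] // [[|[|[|t]]] ?] // [[|[|[|z]]] ?].
apply: (two (d f_u1 f_v2) (d f_u2 f_v1) (d f_w23 f_v23) (d f_u3 f_x)
            (d f_w13 f_v13) (c f_y)); first [exact: dy|exact: dd].
Qed.

Lemma F1_blow_up_chromatic s t :
  0 < s -> 0 < t -> 4 <= chromatic_number (F1_blow_up s t).
Proof.
move=> s_gt0 t_gt0; rewrite /chromatic_number; case: ex_minnP => k col _.
rewrite leqNgt; apply/negP => k4.
have [g /forallP gP] := existsP col.
have m_gt0 i : 0 < F1_mult s t i by case: i.
pose c (a : F1) : 'I_3 := inord (g (Tagged _ (Ordinal (m_gt0 a)))).
have [a [b [ab cab]]] := F1_not_3_colorable c.
have /forallP/(_ (Tagged _ (Ordinal (m_gt0 b))))/implyP/(_ ab)/negP := gP (Tagged _ (Ordinal (m_gt0 a))).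
case; apply/eqP/val_inj; have := congr1 val cab.
by rewrite /= !inordK //; apply: leq_trans (ltn_ord _) _.
Qed.

Import Order.TTheory GRing.Theory Num.Theory.
Local Open Scope ring_scope.

(** * Rayleigh quotients and nonnegative eigenvectors *)

(** Diagonalize over the complex numbers: the quadratic form becomes a combination
   of squared moduli with the eigenvalues as coefficients. *)
Lemma symmetric_rayleigh (R : realType) n (A : 'M[R]_n) (r : R) :
    A^T = A -> (forall a, eigenvalue A a -> a <= r) ->
  forall z : 'rV_n, (z *m A *m z^T) 0 0 <= r * (z *m z^T) 0 0.
Proof.
move=> Asym Ar z; pose f : {rmorphism R -> complex R} := real_complex R.
pose Ac := map_mx f A; pose P := spectralmx Ac.
have fconj (m p : nat) (B : 'M[R]_(m, p)) :
    map_mx Num.conj (map_mx f B) = map_mx f B.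
  by apply/matrixP => i j; rewrite !mxE conj_Creal // complex_real.
have Aherm : Ac \is hermsymmx.
  apply/is_hermitianmxP; by rewrite expr0 scale1r /Ac map_trmx Asym fconj.
have PU : P \is unitarymx := spectral_unitarymx Ac.
have /orthomx_spectralP AcE := hermitian_normalmx Aherm.
set d := spectral_diag Ac in AcE.
have PK : map_mx Num.conj P^T *m P = 1%:M.
  by rewrite -invmx_unitary // mulVmx // spectral_unit.
have ztc : (map_mx f z)^T = map_mx Num.conj (map_mx f z)^T.
  by rewrite map_trmx fconj.
pose y := map_mx f z *m map_mx Num.conj P^T.
have yt : P *m (map_mx f z)^T = map_mx Num.conj y^T.
  rewrite /y trmx_mul map_mxM.
  rewrite [in LHS]ztc; congr (_ *m _); exact/esym/(trmxCK P).
have qE : f ((z *m A *m z^T) 0 0) = \sum_i d 0 i * (y 0 i * (y 0 i)^*).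
  have -> : f ((z *m A *m z^T) 0 0) = (map_mx f (z *m A *m z^T)) 0 0.
    by rewrite [RHS]mxE.
  rewrite !map_mxM -/Ac AcE invmx_unitary // -[map_mx f z^T]map_trmx.
  rewrite mulmxA mulmxA -mulmxA yt -/y mul_mx_diag mxE.
  by apply: eq_bigr => i _; rewrite !mxE; ring.
have nE : f ((z *m z^T) 0 0) = \sum_i y 0 i * (y 0 i)^*.
  have -> : f ((z *m z^T) 0 0) = (map_mx f (z *m z^T)) 0 0.
    by rewrite [RHS]mxE.
  rewrite map_mxM -map_trmx.
  have -> : map_mx f z *m (map_mx f z)^T = y *m map_mx Num.conj y^T.
    by rewrite -yt /y mulmxA -(mulmxA _ _ P) PK mulmx1.
  by rewrite mxE; apply: eq_bigr => i _; rewrite !mxE.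
have dr i : d 0 i <= f r.
  have dreal : d 0 i \is Num.real.
    by have /mxOverP := hermitian_spectral_diag_real Aherm; apply.
  have dE : d 0 i = f (complex.Re (d 0 i)) by rewrite /= RRe_real.
  rewrite dE /= lecR; apply: Ar.
  rewrite -(eigenvalue_map f) -dE -/Ac.
  apply/eigenvalueP; exists (row i P).
    rewrite -row_mul [X in P *m X]AcE mulmxA mulmxA mulmxV ?spectral_unit //.
    rewrite mul1mx; apply/rowP => j; rewrite !mxE (bigD1 i) //= big1 => [|k ki].
      by rewrite !mxE eqxx mulr1n addr0.
    by rewrite !mxE eq_sym (negPf ki) mulr0n mul0r.
  apply: contraTneq (spectral_unit Ac) => Pi0.
  have := congr1 (mulmx^~ (invmx P)) Pi0.
  rewrite -row_mul mul0mx; case: (boolP (P \in unitmx)) => // PV.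
  rewrite mulmxV // => /rowP/(_ i); rewrite !mxE eqxx => /eqP.
  by rewrite oner_eq0.
rewrite -lecR -[_ %:C%C]/(f _) -[(r * _)%:C%C]/(f _) rmorphM qE nE mulr_sumr.
by apply: ler_sum => i _; apply: ler_wpM2r => //; apply: mul_conjC_ge0.
Qed.

(** The form q of M = r - A is nonnegative and vanishes at z.  If y = z M were
   not zero, q would be negative at z + t y for small negative t. *)
Lemma rayleigh_maximizer (R : realType) n (A : 'M[R]_n) (r : R) (z : 'rV_n) :
    A^T = A -> (forall a, eigenvalue A a -> a <= r) ->
  r * (z *m z^T) 0 0 <= (z *m A *m z^T) 0 0 -> z *m A = r *: z.
Proof.
move=> Asym Ar zmax; pose M := r%:M - A.
have Msym : M^T = M by rewrite /M linearB /= tr_scalar_mx Asym.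
have qE (v : 'rV_n) :
    (v *m M *m v^T) 0 0 = r * (v *m v^T) 0 0 - (v *m A *m v^T) 0 0.
  by rewrite /M mulmxBr mulmxBl mul_mx_scalar -scalemxAl 2![in LHS]mxE [X in _ + X]mxE.
have q_ge0 (v : 'rV_n) : 0 <= (v *m M *m v^T) 0 0.
  by rewrite qE subr_ge0 symmetric_rayleigh.
have q0 : (z *m M *m z^T) 0 0 = 0.
  by apply/eqP; rewrite eq_le q_ge0 qE subr_le0 zmax.
have ME : M = r%:M - A by [].
have [y yE] : exists y, z *m M = y by exists (z *m M).
clearbody M; pose s := (y *m y^T) 0 0; pose q := (y *m M *m y^T) 0 0.
have sE : s = \sum_i y 0 i ^+ 2.
  by rewrite /s mxE; apply: eq_bigr => i _; rewrite [y^T _ _]mxE expr2.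
have expand t : ((z + t *: y) *m M *m (z + t *: y)^T) 0 0
    = 2 * t * s + t ^+ 2 * q.
  have -> : (z + t *: y) *m M *m (z + t *: y)^T = z *m M *m z^T +
      t *: (y *m M *m z^T) + t *: (y *m y^T) + t ^+ 2 *: (y *m M *m y^T).
    have -> : (z + t *: y)^T = z^T + t *: y^T by apply/matrixP => i j; rewrite !mxE.
    rewrite !mulmxDl !mulmxDr -!scalemxAl -!scalemxAr yE.
    move: (_ *m z^T) (y *m y^T) (_ *m z^T) (_ *m y^T) => a b c d.
    by apply/matrixP => i j; rewrite !mxE; ring.
  have -> : y *m M *m z^T = y *m y^T.
    by rewrite -mulmxA; congr (_ *m _); rewrite -yE trmx_mul Msym.
  have entry (a b c d : 'M[R]_1) : (a + t *: b + t *: c + t ^+ 2 *: d) 0 0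
      = a 0 0 + t * b 0 0 + t * c 0 0 + t ^+ 2 * d 0 0 by rewrite !mxE.
  by rewrite entry q0 add0r -/s -/q; ring.
have q_ge : 0 <= q := q_ge0 y.
have s_ge0 : 0 <= s by rewrite sE sumr_ge0 // => i _; rewrite sqr_ge0.
have s0 : s = 0.
  have q1 : 0 < q + 1 by lra.
  have := q_ge0 (z + (- (s / (q + 1))) *: y); rewrite expand.
  have -> : 2 * - (s / (q + 1)) * s + (- (s / (q + 1))) ^+ 2 * q
      = - ((s / (q + 1)) ^+ 2 * (q + 2)).
    by field; exact: lt0r_neq0.
  rewrite oppr_ge0 pmulr_lle0; last by lra.
  move=> h; have /eqP : (s / (q + 1)) ^+ 2 = 0 by apply/eqP; rewrite eq_le h sqr_ge0.
  by rewrite sqrf_eq0 mulf_eq0 invr_eq0 (gt_eqF q1) orbF => /eqP.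
have y0 : y = 0.
  apply/rowP => i; rewrite [RHS]mxE; apply/eqP.
  have /eqP := sE; rewrite s0 eq_sym psumr_eq0 => [/allP/(_ i)|j _]; last exact: sqr_ge0.
  by rewrite mem_index_enum sqrf_eq0 => /(_ isT).
have : r *: z - z *m A = 0 by rewrite -[RHS]y0 -yE ME mulmxBr mul_mx_scalar.
by move/subr0_eq.
Qed.

Section FunctionalForm.
Variables (R : realType) (G : sgraph).
Implicit Types (x : G -> R) (z : 'rV[R]_#|G|).

Let rowf x : 'rV[R]_#|G| := \row_i x (enum_val i).

Lemma sum_enum_val (F : G -> R) : \sum_(i < #|G|) F (enum_val i) = \sum_v F v.
Proof.
by rewrite [RHS](reindex _ (onW_bij _ (@enum_val_bij G))).
Qed.

Lemma rowf_adjmx x i :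
  (rowf x *m adjmx R G) 0 i = \sum_(w | adj (enum_val i) w) x w.
Proof.
rewrite mxE [RHS]big_mkcond -[RHS]sum_enum_val; apply: eq_bigr => j _.
by rewrite !mxE adj_sym; case: adj; rewrite ?mulr1 ?mulr0.
Qed.

Lemma adjmx_tr : (adjmx R G)^T = adjmx R G.
Proof. by apply/matrixP => i j; rewrite !mxE adj_sym. Qed.

Lemma rowf_form x :
  (rowf x *m adjmx R G *m (rowf x)^T) 0 0
  = \sum_v x v * \sum_(w | adj v w) x w.
Proof.
rewrite mxE -[RHS]sum_enum_val; apply: eq_bigr => i _.
by rewrite rowf_adjmx !mxE mulrC.
Qed.

Lemma rowf_norm x : (rowf x *m (rowf x)^T) 0 0 = \sum_v x v ^+ 2.
Proof.
by rewrite mxE -[RHS]sum_enum_val; apply: eq_bigr => i _; rewrite !mxE expr2.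
Qed.

(** Passage from row vectors indexed by an enumeration to functions on the
   vertices. *)
Lemma adj_eigenvalueP a : eigenvalue (adjmx R G) a <->
  exists x, (exists v, x v != 0) /\
    forall v, \sum_(w | adj v w) x w = a * x v.
Proof.
split=> [/eigenvalueP[z zA z_neq0]|[x [[v xv] xA]]].
  pose x v := z 0 (enum_rank v).
  have xE : rowf x = z by apply/rowP => i; rewrite !mxE /x enum_valK.
  exists x; split.
    have [i zi] : exists i, z 0 i != 0.
      apply/existsP; apply: contraR z_neq0; rewrite negb_exists => /forallP z0.
      by apply/eqP/rowP => i; rewrite mxE; apply/eqP; have := z0 i; rewrite negbK.
    by exists (enum_val i); rewrite /x enum_valK.
  move=> v; rewrite -(enum_rankK v) -rowf_adjmx xE zA mxE.
  by rewrite /x enum_valK.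
apply/eigenvalueP; exists (rowf x).
  by apply/rowP => i; rewrite rowf_adjmx xA !mxE.
apply: contraNneq xv => /rowP/(_ (enum_rank v)).
by rewrite !mxE enum_rankK => ->.
Qed.

Lemma adj_rayleigh x : (0 < #|G|)%N ->
  \sum_v x v * \sum_(w | adj v w) x w
    <= spectral_radius R G * \sum_v x v ^+ 2.
Proof.
move=> /(spectral_radius_max R)[_ Gr].
by rewrite -rowf_form -rowf_norm; apply: symmetric_rayleigh => //; apply: adjmx_tr.
Qed.

(** The absolute values of an eigenvector for the spectral radius have at least
   the same Rayleigh quotient, so they form an eigenvector too. *)
Lemma perron : (0 < #|G|)%N -> exists x v,
  [/\ x v = 1, (forall w, 0 <= x w <= 1) &
      forall u, \sum_(w | adj u w) x w = spectral_radius R G * x u].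
Proof.
move=> G_gt0; have [rG Gr] := spectral_radius_max R G_gt0.
set r := spectral_radius R G in rG Gr *.
have /adj_eigenvalueP[z [[v0 zv0] zA]] := rG.
pose y v := `|z v|.
have yA u : \sum_(w | adj u w) y w = r * y u.
  have : rowf y *m adjmx R G = r *: rowf y.
    apply: rayleigh_maximizer => //; first exact: adjmx_tr.
    rewrite rowf_form rowf_norm mulr_sumr; apply: ler_sum => w _.
    rewrite /y real_normK ?num_real // expr2 mulrCA -zA.
    apply: le_trans (ler_norm _) _; rewrite normrM ler_wpM2l //.
    exact: ler_norm_sum.
  by move=> /rowP/(_ (enum_rank u)); rewrite rowf_adjmx !mxE enum_rankK.
have [v _ vmax] := arg_maxP y (erefl : xpredT v0).
have yv_gt0 : 0 < y v by apply: lt_le_trans (vmax v0 _); rewrite ?normr_gt0.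
exists (fun w => y w / y v), v; split.
- by rewrite divff // gt_eqF.
- move=> w; rewrite divr_ge0 ?normr_ge0 // ?(ltW yv_gt0) //=.
  by rewrite ler_pdivrMr // mul1r; apply: vmax.
- by move=> u; rewrite -mulr_suml yA mulrA.
Qed.

End FunctionalForm.

Lemma iso_spectral_radius (R : realType) (G H : sgraph) :
  isomorphic G H -> spectral_radius R G = spectral_radius R H.
Proof.
case=> f [g fK gK] fadj; rewrite /spectral_radius; congr (sup _).
apply/classical_sets.seteqP; split=> a /= /adj_eigenvalueP[x [[v xv] xA]];
    apply/adj_eigenvalueP.
  exists (x \o g); split; first by exists (f v); rewrite /= fK.
  move=> u; rewrite -[RHS]xA (reindex f) /=; last by exists g => ? _.
  by apply: eq_big => [w|w _]; rewrite ?fK // -[u in LHS]gK fadj.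
exists (x \o f); split; first by exists (g v); rewrite /= gK.
move=> u; rewrite -[RHS]xA [RHS](reindex f) /=; last by exists g => ? _.
by apply: eq_bigl => w; rewrite fadj.
Qed.

(** * The quotient eigenproblem of a blow-up *)

Section Sums.
Variables (R : realType) (s t : nat).
Notation F := (F1_blow_up s t).

Definition vertex_copy (i : F1) (k : 'I_(F1_mult s t i)) : F := existT _ i k.

Lemma blow_up_sum (f : F1 -> R) :
  \sum_(v : F) f (tag v) = \sum_(i : F1) (F1_mult s t i)%:R * f i.
Proof.
transitivity (\sum_(i : F1) \sum_(k < F1_mult s t i) f i).
  by rewrite (sig_big_dep _ (fun i _ => true) (fun i _ => f i)).
by apply: eq_bigr => i _; rewrite sumr_const card_ord mulr_natl.
Qed.

Lemma blow_up_nbr_sum (x : F -> R) (v : F) :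
  \sum_(w | adj v w) x w
  = \sum_(i : F1 | adj (tag v) i) \sum_(k < F1_mult s t i) x (vertex_copy k).
Proof.
rewrite (sig_big_dep (fun i : F1 => adj (tag v) i) (fun i _ => true) (fun i k => x (@vertex_copy i k))) /=.
by apply: eq_big => [[i k]|[i k] _] //=; rewrite andbT.
Qed.

Lemma sum_F1 (f : F1 -> R) : \sum_(i : F1) f i =
  f f_v13 + f f_v23 + f f_v1 + f f_v2 + f f_x + f f_u1 + f f_u2 + f f_u3
  + f f_w13 + f f_w23 + f f_y.
Proof. by rewrite index_F1 !big_cons big_nil; ring. Qed.

End Sums.

Section Quotient.
Variables (R : realType) (s t : nat).
Notation F := (F1_blow_up s t).
Let rho : R := spectral_radius R F.

(** The order of the arguments is that of the list of vertices. *)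
Definition F1_vec (e13 e23 e1 e2 ex a1 a2 a3 b13 b23 ey : R) (i : F1) : R :=
  match i with
  | f_v13 => e13 | f_v23 => e23 | f_v1 => e1 | f_v2 => e2 | f_x => ex
  | f_u1 => a1 | f_u2 => a2 | f_u3 => a3 | f_w13 => b13 | f_w23 => b23
  | f_y => ey end.

Lemma F1_nbr_sum (f : F1 -> R) (i : F1) : \sum_(j : F1 | adj i j) f j =
  F1_vec (f f_y + f f_u1 + f f_u3) (f f_y + f f_u2 + f f_u3)
    (f f_y + f f_u1 + f f_w23) (f f_y + f f_u2 + f f_w13)
    (f f_y + f f_w13 + f f_w23)
    (f f_u2 + f f_v13 + f f_v1 + f f_w13)
    (f f_u1 + f f_v23 + f f_v2 + f f_w23)
    (f f_v13 + f f_v23 + f f_w13 + f f_w23)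
    (f f_x + f f_u1 + f f_u3 + f f_v2) (f f_x + f f_u2 + f f_u3 + f f_v1)
    (f f_v13 + f f_v23 + f f_v1 + f f_v2 + f f_x) i.
Proof.
rewrite big_mkcond sum_F1; case: i;
  repeat match goal with |- context [if ?b then _ else _] =>
    let b' := eval vm_compute in b in change b with b' end;
  rewrite /F1_vec /=; ring.
Qed.

Let m (i : F1) : R := (F1_mult s t i)%:R.

Lemma quotient_rayleigh (f : F1 -> R) : (0 < #|F|)%N ->
  \sum_i m i * (f i * \sum_(j | adj i j) m j * f j)
    <= rho * \sum_i m i * f i ^+ 2.
Proof.
move=> F_gt0; have := adj_rayleigh (fun v : F => f (tag v)) F_gt0.
rewrite (blow_up_sum s t (fun i => f i ^+ 2)).
rewrite -(blow_up_sum s t (fun i => f i * \sum_(j | adj i j) m j * f j)).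
congr (_ <= _); apply: eq_bigr => v _; congr (_ * _).
rewrite blow_up_nbr_sum; apply: eq_bigr => i _.
by rewrite /= sumr_const card_ord mulr_natl.
Qed.

(** The eigenvalue equation holds with l at all classes but one, where it holds
   with a strict inequality in the favourable direction; thus the Rayleigh
   quotient of f exceeds l. *)
Lemma quotient_supersolution (f : F1 -> R) (l : R) (i0 : F1) :
    (0 < F1_mult s t i0)%N ->
    (forall i, i != i0 -> \sum_(j | adj i j) m j * f j = l * f i) ->
    0 < f i0 -> l * f i0 < \sum_(j | adj i0 j) m j * f j ->
  l < rho.
Proof.
move=> m_gt0 fE fi0 fl.
have F_gt0 : (0 < #|F|)%N by rewrite card_F1_blow_up addnS.
have := quotient_rayleigh f F_gt0; set S := \sum_(i : F1) m i * f i ^+ 2.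
have S_ge0 : 0 <= S.
  by apply: sumr_ge0 => i _; rewrite mulr_ge0 ?ler0n ?sqr_ge0.
have -> : \sum_i m i * (f i * \sum_(j | adj i j) m j * f j)
    = l * S + m i0 * f i0 * (\sum_(j | adj i0 j) m j * f j - l * f i0).
  rewrite /S (bigD1 i0) //= [X in l * X](bigD1 i0) //=.
  rewrite [X in _ + X](eq_bigr (fun i => l * (m i * f i ^+ 2))); last first.
    by move=> i /fE ->; ring.
  by rewrite -mulr_sumr; ring.
move=> le_rho; rewrite ltNge; apply/negP => rho_le.
have : rho * S <= l * S by apply: ler_wpM2r.
have : 0 < m i0 * f i0 * (\sum_(j | adj i0 j) m j * f j - l * f i0).
  by rewrite !mulr_gt0 ?subr_gt0 // ltr0n.
lra.
Qed.

(** The sums of a nonnegative eigenvector over the classes. *)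
Lemma quotient_perron : 0 < rho -> exists S : F1 -> R,
  [/\ forall i, 0 <= S i, exists i, S i != 0 &
      forall i, rho * S i = m i * \sum_(j | adj i j) S j].
Proof.
move=> rho_gt0; have F_gt0 : (0 < #|F|)%N by rewrite card_F1_blow_up addnS.
have [x [v0 [xv0 x01 xA]]] := perron R F_gt0.
have x_ge0 v : 0 <= x v by case/andP: (x01 v).
exists (fun i => \sum_(k < F1_mult s t i) x (vertex_copy k)); split.
- by move=> i; apply: sumr_ge0.
- exists (tag v0); apply: contraTneq (oner_neq0 R) => /eqP.
  rewrite psumr_eq0 // => /allP/(_ (tagged v0) (mem_index_enum _)).
  by case: v0 xv0 => i k /= <-; rewrite negbK.
move=> i; rewrite mulr_sumr.
rewrite (eq_bigr (fun _ => \sum_(j | adj i j) \sum_(k < F1_mult s t j) x (vertex_copy k))).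
  by rewrite sumr_const card_ord mulr_natl.
by move=> k _; rewrite -xA blow_up_nbr_sum.
Qed.

End Quotient.

(** * Lower bound and comparison of the two balanced blow-ups *)

(** The Rayleigh quotient of the vector that is 0 on u1, u2, u3 and 1
   elsewhere. *)
Lemma F1_blow_up_lower (R : realType) (s t : nat) :
  2 * ((s%:R + 4) * (t%:R + 2) - 6)
    <= spectral_radius R (F1_blow_up s t) * (s%:R + t%:R + 6) :> R.
Proof.
have F_gt0 : (0 < #|F1_blow_up s t|)%N by rewrite card_F1_blow_up addnS.
pose f : F1 -> R := F1_vec 1 1 1 1 1 0 0 0 1 1 1.
have := quotient_rayleigh f F_gt0.
rewrite (eq_bigr _ (fun i _ => congr1 (fun z => _ * (_ * z)) (F1_nbr_sum _ i))).
rewrite !sum_F1 /= /f /=; set r := spectral_radius _ _ => h.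
by move: h; congr (_ <= _); ring.
Qed.

Section Compare.
Variable R : realType.
Implicit Types l P Q p q r c w : R.

(** Determinant of [small_system]; the three polynomials below it give, after
   division by it, the responses of w and of p + q to P and Q. *)
Definition detF1 l := l ^+ 5 - l ^+ 4 - 8 * l ^+ 3 + 3 * l ^+ 2 + 7 * l - 2.
Definition coefXX l := 2 * l ^+ 4 - 2 * l ^+ 3 - 8 * l ^+ 2 + 4 * l + 4.
Definition coefXY l := 2 * l ^+ 3 + 6 * l ^+ 2 - 8 * l.
Definition coefYY l := 4 * l ^+ 4 - 4 * l ^+ 3 - 18 * l ^+ 2 + 22 * l - 4.

(** The eigenvalue equations at the vertices other than x and y.  P and Q are
   the total weights of the copies of x and y, and p, q, r, w those of the pairs
   v13, v23; v1, v2; u1, u2; w13, w23, which the symmetry of the graph exchanges; c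
   is the weight of u3. *)
Definition small_system l P Q p q r c w : Prop :=
  [/\ l * p = 2 * Q + r + 2 * c, l * q = 2 * Q + r + w,
      l * r = r + p + q + w, l * c = p + w &
      l * w = 2 * P + q + r + 2 * c].

(** Cramer's rule; the multipliers are the cofactors of the system. *)
Lemma small_system_solved l P Q p q r c w :
    small_system l P Q p q r c w ->
  detF1 l * w = coefXX l * P + coefXY l * Q /\
  detF1 l * (p + q) = coefXY l * P + coefYY l * Q.
Proof.
case=> ep eq er ec ew.
have z1 : l * p - (2 * Q + r + 2 * c) = 0 by rewrite ep subrr.
have z2 : l * q - (2 * Q + r + w) = 0 by rewrite eq subrr.
have z3 : l * r - (r + p + q + w) = 0 by rewrite er subrr.
have z4 : l * c - (p + w) = 0 by rewrite ec subrr.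
have z5 : l * w - (2 * P + q + r + 2 * c) = 0 by rewrite ew subrr.
have comb (k1 k2 k3 k4 k5 : R) :
    k1 * (l * p - (2 * Q + r + 2 * c)) + k2 * (l * q - (2 * Q + r + w))
    + k3 * (l * r - (r + p + q + w)) + k4 * (l * c - (p + w))
    + k5 * (l * w - (2 * P + q + r + 2 * c)) = 0.
  by rewrite z1 z2 z3 z4 z5 !mulr0 !addr0.
split; apply/eqP; rewrite -subr_eq0; apply/eqP.
  rewrite -(comb (3 * l ^+ 2 - l - 2) (l ^+ 3 - 3 * l + 2) (l ^+ 3 + l ^+ 2 - 2)
    (2 * l ^+ 3 - 2 * l ^+ 2 - 2 * l + 2) (l ^+ 4 - l ^+ 3 - 4 * l ^+ 2 + 2 * l + 2)).
  by rewrite /detF1 /coefXX /coefXY; ring.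
rewrite -(comb (l ^+ 4 - l ^+ 3 - 4 * l ^+ 2 + 4 * l) (l ^+ 4 - l ^+ 3 - 5 * l ^+ 2 + 7 * l - 2)
  (2 * l ^+ 3 + l ^+ 2 - 5 * l + 2) (2 * l ^+ 3 - 2 * l)
  (l ^+ 3 + 3 * l ^+ 2 - 4 * l)).
by rewrite /detF1 /coefXY /coefYY; ring.
Qed.

Lemma small_system_solvable l P Q : detF1 l != 0 ->
  exists p q r c w, small_system l P Q p q r c w.
Proof.
move=> D0; pose D := detF1 l.
exists (((6 * l ^+ 2 - 2 * l - 4) * P + (2 * l ^+ 4 - 2 * l ^+ 3 - 8 * l ^+ 2 + 8 * l) * Q) / D).
exists (((2 * l ^+ 3 - 6 * l + 4) * P + (2 * l ^+ 4 - 2 * l ^+ 3 - 10 * l ^+ 2 + 14 * l - 4) * Q) / D).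
exists (((2 * l ^+ 3 + 2 * l ^+ 2 - 4) * P + (4 * l ^+ 3 + 2 * l ^+ 2 - 10 * l + 4) * Q) / D).
exists (((2 * l ^+ 3 - 2 * l ^+ 2 - 2 * l + 2) * P + (2 * l ^+ 3 - 2 * l) * Q) / D).
exists ((coefXX l * P + coefXY l * Q) / D).
by split; apply: (mulfI D0); rewrite /D /coefXX /coefXY /detF1; field;
   exact: D0.
Qed.

(** Horner's scheme: once a partial value is large in absolute value, l >= 10
   outweighs every later coefficient.  The last polynomial is the difference of
   determinants met in [F1_sides_compare]; its leading term is - 14 l^8. *)
Lemma poly_signs l : 10 <= l ->
  [/\ 0 < detF1 l, 0 < coefXX l, 0 < coefXY l, 0 < detF1 l - coefXX l &
      l * detF1 l * (coefXX l - coefYY l) - 2 * (coefXX l * coefYY l)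
      + 2 * (detF1 l + coefXY l) ^+ 2 < 0].
Proof.
move=> l10.
have up (x c : R) : 2 <= x -> - 18 <= c -> 2 <= x * l + c by nra.
have down (x c : R) : x <= - 50 -> c <= 402 -> x * l + c <= - 50 by nra.
have gt2 (x : R) : 2 <= x -> 0 < x by lra.
split.
- have -> : detF1 l = (((((l - 1) * l - 8) * l + 3) * l + 7) * l - 2).
    by rewrite /detF1 /coefXX; ring.
  by apply: (gt2); repeat (apply: (up); last lra); lra.
- have -> : coefXX l = ((((2 * l - 2) * l - 8) * l + 4) * l + 4).
    by rewrite /detF1 /coefXX; ring.
  by apply: (gt2); repeat (apply: (up); last lra); lra.
- have -> : coefXY l = ((2 * l + 6) * l - 8) * l by rewrite /coefXY; ring.
  by apply: mulr_gt0; [apply: (gt2); repeat (apply: (up); last lra); lra|lra].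
- have -> : detF1 l - coefXX l = (((((l - 3) * l - 6) * l + 11) * l + 3) * l - 6).
    by rewrite /detF1 /coefXX; ring.
  by apply: (gt2); repeat (apply: (up); last lra); lra.
- have -> : l * detF1 l * (coefXX l - coefYY l) - 2 * (coefXX l * coefYY l)
      + 2 * (detF1 l + coefXY l) ^+ 2
    = ((((((((- 14 * l + 42) * l + 90) * l - 292) * l - 42) * l + 402) * l - 74) * l - 152) * l + 40).
    by rewrite /detF1 /coefXX /coefXY /coefYY; ring.
  by apply: (@le_lt_trans _ _ (- 50)); [do 7 (apply: (down); last lra); lra|lra].
Qed.

End Compare.

Section Sides.
Variable R : realType.
Implicit Types l P Q p q r c w : R.

(** The eigenvalue equations at x and y, with the other classes eliminated,
   are two linear equations in P and Q with a solution in which neither vanishes. *)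
Lemma quotient_det (s t : nat) (l := spectral_radius R (F1_blow_up s t)) :
    (0 < s)%N -> (0 < t)%N -> 10 <= l ->
  (l * detF1 l - coefXX l * s%:R) * (l * detF1 l - coefYY l * t%:R)
  = s%:R * t%:R * (detF1 l + coefXY l) ^+ 2.
Proof.
move=> s_gt0 t_gt0 l10; have [D_gt0 _ b_gt0 _ _] := poly_signs l10.
have l_gt0 : 0 < l by lra.
have [S [S_ge0 [i0 Si0] SE]] := quotient_perron l_gt0.
have E i := etrans (SE i) (congr1 ( *%R _) (F1_nbr_sum S i)).
rewrite -/l in E.
have /= Ex := E f_x; have /= Ey := E f_y.
have /= E13 := E f_v13; have /= E23 := E f_v23.
have /= E1 := E f_v1; have /= E2 := E f_v2.
have /= Ea1 := E f_u1; have /= Ea2 := E f_u2; have /= Ea3 := E f_u3.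
have /= Eb13 := E f_w13; have /= Eb23 := E f_w23.
set P := S f_x in Ex Ey Eb13 Eb23 *; set Q := S f_y in Ex Ey E13 E23 E1 E2 *.
pose p := S f_v13 + S f_v23; pose q := S f_v1 + S f_v2.
pose r := S f_u1 + S f_u2; pose w := S f_w13 + S f_w23.
have sys : small_system l P Q p q r (S f_u3) w.
  by split; rewrite /p /q /r /w; lra.
have [wE pqE] := small_system_solved sys.
have lP : l * P = s%:R * (Q + w) by rewrite Ex /w; ring.
have lQ : l * Q = t%:R * (P + (p + q)) by rewrite Ey /p /q; ring.
have DP : (l * detF1 l - coefXX l * s%:R) * P = s%:R * (detF1 l + coefXY l) * Q.
  have -> : (l * detF1 l - coefXX l * s%:R) * P
    = detF1 l * (l * P) - coefXX l * s%:R * P by ring.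
  by rewrite lP mulrCA mulrDr wE; ring.
have DQ : (l * detF1 l - coefYY l * t%:R) * Q = t%:R * (detF1 l + coefXY l) * P.
  have -> : (l * detF1 l - coefYY l * t%:R) * Q
    = detF1 l * (l * Q) - coefYY l * t%:R * Q by ring.
  by rewrite lQ mulrCA mulrDr pqE; ring.
have sR : 0 < s%:R :> R by rewrite ltr0n.
have tR : 0 < t%:R :> R by rewrite ltr0n.
have Db : 0 < detF1 l + coefXY l by lra.
(* If P or Q vanished, both would, and then every class sum, all of them being
   nonnegative. *)
have all0 : P = 0 \/ Q = 0 -> False.
  move=> PQ0; have [P0 Q0] : P = 0 /\ Q = 0.
    case: PQ0 => z0; split=> //.
      move: DP; rewrite z0 mulr0 => /esym/eqP; rewrite !mulf_eq0.
      by rewrite (gt_eqF sR) (gt_eqF Db) => /eqP.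
    move: DQ; rewrite z0 mulr0 => /esym/eqP; rewrite !mulf_eq0.
    by rewrite (gt_eqF tR) (gt_eqF Db) => /eqP.
  have w0 : w = 0.
    by move: lP; rewrite P0 Q0 mulr0 add0r => /esym/eqP; rewrite mulf_eq0 (gt_eqF sR) => /eqP.
  have pq0 : p + q = 0.
    by move: lQ; rewrite P0 Q0 mulr0 add0r => /esym/eqP; rewrite mulf_eq0 (gt_eqF tR) => /eqP.
  have [_ _ rE cE _] := sys.
  have r0 : r = 0.
    have : (l - 1) * r = 0 by rewrite mulrBl rE mul1r; lra.
    by move/eqP; rewrite mulf_eq0 => /orP[/eqP|/eqP//]; lra.
  have p_ge0 : 0 <= p by rewrite addr_ge0.
  have q_ge0 : 0 <= q by rewrite addr_ge0.
  have c0 : S f_u3 = 0.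
    have : l * S f_u3 = 0 by rewrite cE; lra.
    by move/eqP; rewrite mulf_eq0 (gt_eqF l_gt0) => /eqP.
  move: Si0; apply/negP; rewrite negbK; apply/eqP.
  have add0 (x y : R) : 0 <= x -> 0 <= y -> x + y = 0 -> x = 0 /\ y = 0.
    by clear; split; lra.
  have [p0 q0] := add0 _ _ p_ge0 q_ge0 pq0.
  have [? ?] := add0 _ _ (S_ge0 _) (S_ge0 _) p0.
  have [? ?] := add0 _ _ (S_ge0 _) (S_ge0 _) q0.
  have [? ?] := add0 _ _ (S_ge0 _) (S_ge0 _) r0.
  have [? ?] := add0 _ _ (S_ge0 _) (S_ge0 _) w0.
  by case: i0.
have PQ : P * Q != 0.
  by rewrite mulf_neq0 //; apply/eqP => z0; apply: all0; [left|right].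
apply: (mulIf PQ); rewrite mulrACA DP DQ; ring.
Qed.

(** At l, the spectral radius of the first graph, the determinant of the first
   graph vanishes.  Passing to the second graph changes s t by - 2 and s and t by
   - 1 and + 1, so the determinant changes by the last polynomial of [poly_signs]
   and becomes negative.  This yields a solution of all equations of the second
   graph but that of y, where there is strict excess. *)
Lemma F1_sides_compare (k : nat) : (20 <= k)%N ->
  spectral_radius R (F1_blow_up (k - 3) (k - 2))
    < spectral_radius R (F1_blow_up (k - 4) (k - 1)).
Proof.
move=> k20; set l := spectral_radius R (F1_blow_up (k - 3) (k - 2)).
have le_k j : (j <= 20)%N -> (j <= k)%N by move=> j20; apply: leq_trans k20.
have k20R : 20 <= k%:R :> R by rewrite ler_nat.
have l_ge : k%:R - 1 <= l.
  have := F1_blow_up_lower R (k - 3) (k - 2); rewrite -/l.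
  rewrite !natrB ?le_k // => h.
  have : (k%:R - 1) * (2 * k%:R + 1) <= l * (2 * k%:R + 1) by nra.
  by rewrite ler_pM2r //; lra.
have l10 : 10 <= l by lra.
have [D_gt0 a_gt0 b_gt0 Da_gt0 G_lt0] := poly_signs l10.
have := @quotient_det (k - 3) (k - 2); rewrite /= -/l => det.
have {}det : (l * detF1 l - coefXX l * (k%:R - 3)) * (l * detF1 l - coefYY l * (k%:R - 2))
  = (k%:R - 3) * (k%:R - 2) * (detF1 l + coefXY l) ^+ 2.
  by move: det; rewrite !natrB ?le_k //; apply; rewrite // subn_gt0 le_k.
have solved P Q p q r c w := @small_system_solved R l P Q p q r c w.
set D := detF1 l in solved D_gt0 Da_gt0 G_lt0 det; set a := coefXX l in solved a_gt0 Da_gt0 G_lt0 det.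
set b := coefXY l in solved b_gt0 G_lt0 det; set d := coefYY l in solved G_lt0 det.
have solvable P Q := @small_system_solvable R l P Q (lt0r_neq0 D_gt0).
clearbody D a b d.
pose s : R := k%:R - 4; pose t : R := k%:R - 1.
have key : (l * D - a * s) * (l * D - d * t) < s * t * (D + b) ^+ 2.
  rewrite /s /t; move: det G_lt0; move: (k%:R) => K det G_lt0.
  rewrite -subr_lt0; apply: le_lt_trans G_lt0; rewrite le_eqVlt; apply/orP; left.
  by rewrite -subr_eq0; apply/eqP; move/eqP: det; rewrite -subr_eq0 => /eqP <-; ring.
have [sE tE] : (k - 4)%:R = s /\ (k - 1)%:R = t.
  by rewrite /s /t !natrB ?le_k.
have [s_gt0 t_gt0 sl] : [/\ 0 < s, 0 < t & s < l] by rewrite /s /t; split; lra.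
clearbody s t.
have [P PE] : exists P, P = s * (D + b) by exists (s * (D + b)).
have [Q QE] : exists Q, Q = l * D - a * s by exists (l * D - a * s).
have [p [q [r [c [w sys]]]]] := solvable P Q.
have [wE pqE] := solved _ _ _ _ _ _ _ sys.
case: sys => ep eq er ec ew.
have Q_gt0 : 0 < Q.
  have -> : Q = l * (D - a) + a * (l - s) by rewrite QE; ring.
  by rewrite addr_gt0 // mulr_gt0 // ?subr_gt0 //; apply: lt_le_trans l10.
have lP : l * P = s * (Q + w).
  apply: (mulfI (lt0r_neq0 D_gt0)).
  have -> : D * (s * (Q + w)) = s * (D * Q + D * w) by ring.
  by rewrite wE PE QE; ring.
have lQ : l * Q < t * (P + (p + q)).
  rewrite -(ltr_pM2l D_gt0).
  have -> : D * (t * (P + (p + q))) = t * (D * P + D * (p + q)) by ring.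
  rewrite pqE -subr_gt0.
  have -> : t * (D * P + (b * P + d * Q)) - D * (l * Q)
    = s * t * (D + b) ^+ 2 - (l * D - a * s) * (l * D - d * t).
    by rewrite PE QE; ring.
  by rewrite subr_gt0.
pose f := F1_vec (p / 2) (p / 2) (q / 2) (q / 2) (P / s) (r / 2) (r / 2) c
  (w / 2) (w / 2) (Q / t).
have sK : s * (P / s) = P by field; exact: lt0r_neq0.
have tK : t * (Q / t) = Q by field; exact: lt0r_neq0.
apply: (@quotient_supersolution _ _ _ f _ f_y).
- by rewrite /= subn_gt0; apply: leq_trans k20.
- move=> i iy; rewrite (F1_nbr_sum (fun j => _ * f j)).
  case: i iy => //= _; rewrite ?sE ?tE ?sK ?tK; try lra.
  apply: (mulfI (lt0r_neq0 s_gt0)); rewrite [RHS]mulrCA sK lP; field.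
- by [].
- exact: divr_gt0.
- rewrite (F1_nbr_sum (fun j => _ * f j)) /f /= sE sK -(ltr_pM2l t_gt0) mulrCA tK.
  by apply: lt_le_trans lQ _; rewrite le_eqVlt; apply/orP; left; apply/eqP; field.
Qed.

End Sides.

(** * Stability *)

Lemma mul_le_halves (a c : nat) : (a * c <= (a + c)./2 * uphalf (a + c))%N.
Proof.
have [le _] := nat_AGM2 a c; move: le; rewrite uphalf_half.
rewrite -{1}(odd_double_half (a + c)); move: (odd _) (_./2) (a * c)%N => o h z.
by rewrite -mulnn -addnn; case: o => /=; nia.
Qed.

Section Numeric.
Variable R : realType.
Implicit Types r d x a b m : R.

(** The bounds on x together give d (r - 16 - d) <= 13 r, a concave quadratic
   inequality in d that fails between 27 and r - 43. *)
Lemma degree_gap r d x : 1000 <= r -> d * (1 - x) <= 13 -> r * x <= d + 16 ->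
  27 <= d -> r - 43 < d.
Proof.
move=> r_ge dx rx d27; rewrite ltNge; apply/negP => dr.
have : d * (r - (d + 16)) <= 13 * r.
  have : d * (r - (d + 16)) <= d * (r - r * x) by apply: ler_wpM2l; lra.
  have -> : d * (r - r * x) = r * (d * (1 - x)) by ring.
  have : r * (d * (1 - x)) <= r * 13 by apply: ler_wpM2l; lra.
  lra.
have : 0 <= (d - 27) * (r - 43 - d) by apply: mulr_ge0; lra.
lra.
Qed.

Lemma sides_near r a b (M : R) : 1000 <= r -> 0 <= a -> 0 <= b ->
    (a + b) ^+ 2 <= 4 * M + 1 -> M - 49 / 4 <= r ^+ 2 -> r ^+ 2 <= a * b ->
  a * b <= M -> r - 8 < a < r + 8.
Proof.
move=> r_ge a0 b0 ab M1 M2 M3.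
(* Since 4 a b >= 4 r^2 >= 4 M - 49 and (a + b)^2 <= 4 M + 1. *)
have d2 : (a - b) ^+ 2 <= 50.
  have -> : (a - b) ^+ 2 = (a + b) ^+ 2 - 4 * (a * b) by ring.
  lra.
have d1 : a - b < 29 / 4 by nra.
have d1' : b - a < 29 / 4 by nra.
apply/andP; split; rewrite ltNge; apply/negP => h.
  have : a * b <= (r - 8) * (r - 3 / 4) by apply: ler_pM; lra.
  nra.
have : (r + 8) * (r + 3 / 4) <= a * b by apply: ler_pM; lra.
nra.
Qed.

Lemma low_count r a (l : R) : 1000 <= r -> r - 8 < a ->
  l * (a - 26) <= 3 * a + 13 -> l < 4.
Proof. by move=> r_ge ar h; rewrite ltNge; apply/negP => l4; nra. Qed.

(** A vertex with m nonneighbours loses m in its degree and, up to O(m / r), once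
   more m through its smaller eigenvector entry. *)
Lemma deficit_sum r d x m : 30 * 1000 <= r -> r - 43 < d -> 0 <= x <= 1 ->
    m = 0 \/ 1 <= m -> m * (r - 25) - 126 <= r ^+ 2 * (1 - x) ->
  m - 194 * m / r <= d * (1 - x).
Proof.
move=> r_ge rd /andP[x0 x1] [->|m1] h.
  by rewrite mulr0 mul0r subr0; apply: mulr_ge0; lra.
have r0 : 0 < r by lra.
have r2 : 0 < r ^+ 2 by apply: exprn_gt0.
rewrite -(ler_pM2l r2).
have -> : r ^+ 2 * (m - 194 * m / r) = m * (r ^+ 2 - 194 * r) by field; lra.
have -> : r ^+ 2 * (d * (1 - x)) = d * (r ^+ 2 * (1 - x)) by ring.
(* As 1 <= m, the constant 126 may be charged to m: 151 = 25 + 126, and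
   194 = 43 + 151. *)
apply: (@le_trans _ _ ((r - 43) * (m * (r - 151)))).
  nra.
apply: (@le_trans _ _ ((r - 43) * (r ^+ 2 * (1 - x)))).
  by apply: ler_wpM2l; [lra|apply: le_trans h; lra].
by apply: ler_wpM2r; [apply: mulr_ge0; lra|exact: ltW].
Qed.

Lemma near_sum a s p q r : 0 <= s -> p <= a * s -> r * q <= 3276 ->
  r ^+ 2 = p + q -> a < r + 8 -> 30 * 1000 <= r -> r - 9 <= s.
Proof.
move=> s0 ps rq e ar r_ge.
(* The three exceptional vertices contribute at most 1 to r^2. *)
have q1 : q <= 1.
  have : r * (q - 1) <= 0 by lra.
  by rewrite pmulr_rle0; lra.
have : r ^+ 2 - 1 <= (r + 8) * s by nra.
by move=> h; rewrite leNgt; apply/negP => h'; nra.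
Qed.

Lemma error_bound p q b m r : p <= b - 2 * m + 194 * m / r ->
  r * q <= 3276 -> m <= 91 -> 30 * 1000 <= r -> 0 < r ->
  p + q < b - 2 * m + 3 / 4.
Proof.
move=> h1 h2 h3 r_ge r0.
have : r * (p + q) <= r * (b - 2 * m) + 194 * m + 3276.
  have : r * p <= r * (b - 2 * m + 194 * m / r) by rewrite ler_pM2l.
  have -> : r * (b - 2 * m + 194 * m / r) = r * (b - 2 * m) + 194 * m.
    by field; lra.
  lra.
move=> h; rewrite -(ltr_pM2l r0); lra.
Qed.

End Numeric.

Lemma cardsID_pred (T : finType) (A : {set T}) (p : pred T) :
  #|A| = (#|[set z in A | p z]| + #|[set z in A | ~~ p z]|)%N.
Proof.
by rewrite -(cardsID [set z | p z] A); congr (_ + _)%N; apply: eq_card => z;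
  rewrite !inE // andbC.
Qed.

Section Pairs.
Variables (R : realType) (G : sgraph).

Lemma card_pairs (A B : {set G}) :
  \sum_(w in B) #|[set a in A | adj w a]|%:R
    + \sum_(a in A) #|[set w in B | ~~ adj a w]|%:R
  = #|A|%:R * #|B|%:R :> R.
Proof.
have cardE (C : {set G}) (p : pred G) :
    #|[set z in C | p z]|%:R = \sum_(z in C) (p z)%:R :> R.
  rewrite -sum1_card natr_sum big_mkcond [RHS]big_mkcond; apply: eq_bigr => z _.
  by rewrite inE; case: (z \in C); case: (p z).
under eq_bigr do rewrite cardE.
under [X in _ + X]eq_bigr do rewrite cardE.
rewrite exchange_big /= -big_split /=.
rewrite (eq_bigr (fun _ => #|B|%:R)); last first.
  move=> a _; rewrite -big_split /= -sum1_card natr_sum; apply: eq_bigr => w _.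
  by rewrite adj_sym; case: (adj a w); rewrite ?addr0 ?add0r.
by rewrite sumr_const mulr_natl.
Qed.

Lemma card_nonedges (A B : {set G}) : #|nonedges A B|%:R
  = \sum_(w in B) (#|A|%:R - #|[set a in A | adj w a]|%:R) :> R.
Proof.
rewrite sumrB sumr_const -[X in X - _]mulr_natr -card_pairs addrAC subrr add0r.
rewrite -natr_sum -sum1_card; congr _%:R.
rewrite (eq_bigr (fun a => (\sum_(w | (w \in B) && ~~ adj a w) 1)%N)); last first.
  by move=> a _; rewrite -sum1_card; apply: eq_bigl => w; rewrite !inE.
by rewrite pair_big_dep; apply: eq_bigl => -[a w]; rewrite !inE.
Qed.

End Pairs.

Section Stability.
Variables (R : realType) (G : sgraph).
Hypotheses (Gtf : triangle_free G) (chi4 : (4 <= chromatic_number G)%N).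

Let tf (a b c : G) : adj a b -> adj b c -> adj a c = false.
Proof. exact: triangle_freeP. Qed.

(** The eigenvector is normalized by its largest entry, which is attained at v0.
   M is the largest value that |A| (|B| - 3) can take when |A| + |B| = |G|. *)
Section Perron.
Variables (x : G -> R) (v0 : G).
Let rho := spectral_radius R G.
Hypotheses (x01 : forall w, 0 <= x w <= 1) (xv0 : x v0 = 1).
Hypothesis xA : forall u, \sum_(w | adj u w) x w = rho * x u.

Let A := [set w | adj v0 w].
Let B := ~: A.
Let dA w := #|[set a in A | adj w a]|.
Let mB a := #|[set w in B | ~~ adj a w]|.
Let M := ((#|G| - 3)./2 * uphalf (#|G| - 3))%N.
Hypotheses (rho_ge : 30 * 1000 <= rho) (rhoM : M%:R - 49 / 4 <= rho ^+ 2).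

Let x_ge0 w : 0 <= x w. Proof. by case/andP: (x01 w). Qed.
Let x_le1 w : x w <= 1. Proof. by case/andP: (x01 w). Qed.

Let iA : independent A.
Proof.
by move=> a b; rewrite !inE => va; apply: tf; rewrite adj_sym.
Qed.

Lemma rho_sum : rho = \sum_(a in A) x a.
Proof. by rewrite -[LHS]mulr1 -xv0 -xA; apply: eq_bigl => w; rewrite inE. Qed.

(** Count walks of length two from v0; no edge joins two vertices of A. *)
Lemma rho2_sum : rho ^+ 2 = \sum_(w in B) (dA w)%:R * x w.
Proof.
rewrite expr2 {2}rho_sum mulr_sumr.
under eq_bigr do rewrite -xA.
rewrite (exchange_big_dep (fun w => w \in B)) /=; last first.
  by move=> a w aA aw; rewrite inE; apply: contraL aw => wA; rewrite iA.
apply: eq_bigr => w _; rewrite mulr_natl -sumr_const.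
by apply: eq_bigl => a; rewrite inE adj_sym.
Qed.

(** A and the neighbours of a in B are independent, so three vertices lie
   outside of them. *)
Lemma three_misses a : a \in A -> (3 <= mB a)%N.
Proof.
move=> aA; pose C := [set w in B | adj a w].
have iC : independent C.
  move=> b c; rewrite !inE => /andP[_ ab] /andP[_ ac].
  by apply: tf ac; rewrite adj_sym.
have := three_outside Gtf chi4 iA iC; congr (_ < _)%N.
by apply: eq_card => w; rewrite !inE negb_or negb_and; case: (adj v0 w).
Qed.

Lemma AB_card : (#|A| + #|B| = #|G|)%N.
Proof. exact: cardsC. Qed.

Lemma A_gt0 : (0 < #|A|)%N.
Proof.
rewrite lt0n; apply: contraTneq rho_ge => /cards0_eq A0.
by rewrite rho_sum A0 big_set0 -ltNge; lra.
Qed.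

Lemma B_ge3 : (3 <= #|B|)%N.
Proof.
have /card_gt0P[a /three_misses h] := A_gt0; apply: leq_trans h _.
by apply: subset_leq_card; apply/subsetP => w; rewrite inE => /andP[].
Qed.

Lemma product_le_M : (#|A| * (#|B| - 3) <= M)%N.
Proof.
rewrite /M -AB_card; have [c ->] : exists c, #|B| = (c + 3)%N.
  by exists (#|B| - 3)%N; rewrite subnK ?B_ge3.
rewrite addnA !addnK; exact: mul_le_halves.
Qed.

Let a : R := #|A|%:R.
Let b : R := #|B|%:R - 3.

(** Both sums consist of nonnegative terms, so each of their terms is bounded
   by the slack between rho^2 and |A| (|B| - 3). *)
Lemma slack : \sum_(w in B) (dA w)%:R * (1 - x w)
  + \sum_(z in A) ((mB z)%:R - 3) = a * b - rho ^+ 2.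
Proof.
rewrite (eq_bigr (fun w => (dA w)%:R - (dA w)%:R * x w)); last first.
  by move=> w _; rewrite mulrBr mulr1.
rewrite !sumrB -rho2_sum sumr_const -[X in _ + (_ - X)]mulr_natr -/a /b.
rewrite mulrBr -card_pairs -/dA -/mB; ring.
Qed.

Lemma product_le_MR : a * b <= M%:R.
Proof.
have := product_le_M; rewrite -(ler_nat R) natrM natrB ?B_ge3 //.
Qed.

Lemma defect_terms_ge0 w : 0 <= (dA w)%:R * (1 - x w).
Proof. by rewrite mulr_ge0 ?ler0n // subr_ge0. Qed.

Lemma mB_terms_ge0 z : z \in A -> 0 <= (mB z)%:R - 3 :> R.
Proof. by move=> /three_misses; rewrite subr_ge0 ler_nat. Qed.

Lemma slack_le : \sum_(w in B) (dA w)%:R * (1 - x w)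
  + \sum_(z in A) ((mB z)%:R - 3) <= 13.
Proof. by rewrite slack; have := product_le_MR; have := rhoM; lra. Qed.

Lemma defect_le w : w \in B -> (dA w)%:R * (1 - x w) <= 13.
Proof.
move=> wB; apply: le_trans slack_le; rewrite (bigD1 w) //= -addrA lerDl.
rewrite addr_ge0 ?sumr_ge0 // => [w' _|z zA]; first exact: defect_terms_ge0.
exact: mB_terms_ge0.
Qed.

Lemma misses_le z : z \in A -> (mB z <= 16)%N.
Proof.
move=> zA; rewrite -(ler_nat R).
suff : (mB z)%:R - 3 <= 13 :> R by lra.
apply: le_trans slack_le; rewrite [X in _ <= _ + X](bigD1 z) //= addrCA lerDl.
rewrite addr_ge0 ?sumr_ge0 // => [w' _|z' /andP[z'A _]].
  exact: defect_terms_ge0.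
exact: mB_terms_ge0.
Qed.

Lemma missing_le : \sum_(w in B) (a - (dA w)%:R) <= 3 * a + 13.
Proof.
have s0 : 0 <= \sum_(w in B) (dA w)%:R * (1 - x w).
  by apply: sumr_ge0 => w _; apply: defect_terms_ge0.
have := slack_le; rewrite sumrB sumr_const -[X in _ + (_ - X)]mulr_natr -/a.
rewrite sumrB sumr_const -[X in X - _ <= _]mulr_natr -/a -card_pairs -/dA -/mB.
by lra.
Qed.

(** A neighbour a of w in A misses all neighbours of w in B, so there are
   at most 16 of them. *)
Lemma degree_le w : w \in B -> (0 < dA w)%N -> rho * x w <= (dA w)%:R + 16.
Proof.
move=> wB /card_gt0P[z]; rewrite inE => /andP[zA wz].
rewrite -xA -natrD.
apply: (@le_trans _ _ (\sum_(u | adj w u) 1)); first by apply: ler_sum.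
rewrite sumr_const ler_nat.
apply: (@leq_trans (dA w + mB z)); last by rewrite leq_add2l misses_le.
apply: leq_trans (leq_card_setU _ _); apply: subset_leq_card.
apply/subsetP => u wu; rewrite in_setU !in_set; rewrite -topredE /= in wu.
rewrite wu andbT; have [//|/= vu] := boolP (adj v0 u).
by rewrite (@tf z w u) // adj_sym.
Qed.

Lemma degree_dichotomy w : w \in B -> (26 < dA w)%N -> rho - 43 < (dA w)%:R.
Proof.
move=> wB d26; apply: (@degree_gap _ _ _ (x w)).
- by apply: le_trans rho_ge; lra.
- exact: defect_le.
- by apply: degree_le => //; apply: leq_trans d26.
- by rewrite ler_nat.
Qed.

(** The product |A| (|B| - 3) is within a constant of its maximum for the given
   sum, and of rho^2. *)
Lemma a_near : rho - 8 < a < rho + 8.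
Proof.
have b_ge0 : 0 <= b by rewrite /b subr_ge0 ler_nat B_ge3.
apply: (@sides_near _ _ _ b M%:R) => //; first by apply: le_trans rho_ge; lra.
- have -> : a + b = (#|G| - 3)%:R.
    rewrite /a /b -AB_card addrA -natrD natrB //.
    by apply: leq_trans B_ge3 (leq_addl _ _).
  suff : ((#|G| - 3) ^ 2 <= 4 * M + 1)%N by rewrite -(ler_nat R) natrX natrD natrM.
  rewrite /M uphalf_half -{1}(odd_double_half (#|G| - 3)) -addnn -mulnn.
  move: (odd _) (_./2) => o h; case: o => /=; nia.
- by rewrite -subr_ge0 -slack addr_ge0 ?sumr_ge0 // => [w _|z zA];
    [exact: defect_terms_ge0|exact: mB_terms_ge0].
- exact: product_le_MR.
Qed.

Let L := [set w in B | (dA w <= 26)%N].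
Let H := [set w in B | (26 < dA w)%N].

Lemma compl_AH : ~: (A :|: H) = L.
Proof.
apply/setP => w; rewrite !in_set negb_or negb_and -leqNgt.
by case: (adj v0 w).
Qed.

Lemma disjoint_AH : [disjoint A & H].
Proof.
by rewrite -setI_eq0; apply/eqP/setP => w; rewrite !in_set; case: (adj v0 w).
Qed.

Lemma H_degree w : w \in H -> rho - 43 < (dA w)%:R.
Proof. by rewrite inE => /andP[]; apply: degree_dichotomy. Qed.

(** Adjacent vertices have disjoint neighbourhoods in A, but those of vertices
   of H fill more than half of A. *)
Lemma H_independent : independent H.
Proof.
move=> w u wH uH; apply/negP => wu.
have dis : (dA w + dA u <= #|A|)%N.
  rewrite -cardsUI; have -> : [set z in A | adj w z] :&: [set z in A | adj u z] = set0.
    apply/setP => z; rewrite !in_set; apply/negP => /andP[/andP[_ wz] /andP[_ uz]].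
    by move: uz; rewrite (@tf u w z) // adj_sym.
  rewrite cards0 addn0.
  by apply: subset_leq_card; apply/subsetP => z; rewrite !in_set => /orP[]/andP[].
move: dis; rewrite -(ler_nat R) natrD -/a.
have /andP[_] := a_near; have := H_degree wH; have := H_degree uH; have := rho_ge.
lra.
Qed.

Lemma missing_split : \sum_(w in B) (a - (dA w)%:R)
  = #|nonedges A H|%:R + \sum_(w in L) (a - (dA w)%:R).
Proof.
rewrite card_nonedges (bigID (fun w => (26 < dA w)%N)) /=; congr (_ + _).
  by apply: eq_bigl => w; rewrite [RHS]in_set.
by apply: eq_bigl => w; rewrite [RHS]in_set -leqNgt.
Qed.

Lemma missing_L : #|L|%:R * (a - 26) <= \sum_(w in L) (a - (dA w)%:R).
Proof.
rewrite mulr_natl -sumr_const; apply: ler_sum => w; rewrite inE => /andP[_ dw].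
by rewrite lerD2l lerN2 (ler_nat _ _ 26).
Qed.

(** L is what A and H leave out, so it has at least three elements; each of them
   misses nearly all of A, and four of them would miss too much. *)
Lemma card_L : #|L| = 3.
Proof.
apply/eqP; rewrite eqn_leq -compl_AH three_outside ?andbT //; last exact: H_independent.
rewrite compl_AH -ltnS -(ltr_nat R).
have /andP[a1 _] := a_near.
apply: (@low_count _ rho a) => //; first by apply: le_trans rho_ge; lra.
apply: le_trans missing_L _; apply: le_trans missing_le.
by rewrite missing_split lerDr ler0n.
Qed.

Lemma card_H : (#|A| + #|H| = #|G| - 3)%N.
Proof.
have := cardsC (A :|: H); rewrite compl_AH card_L => <-.
by rewrite addnK cardsU disjoint_setI0 ?disjoint_AH // cards0 subn0.
Qed.

Lemma card_H_b : #|H|%:R = b.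
Proof.
apply: (addrI a); rewrite -natrD card_H /a /b -AB_card addrA -natrD natrB //.
by apply: leq_trans B_ge3 (leq_addl _ _).
Qed.

Lemma nonedges_le : #|nonedges A H|%:R <= 91 :> R.
Proof.
have := missing_le; rewrite missing_split; have := missing_L; rewrite card_L.
lra.
Qed.

Section Upper.
Variables (u1 u2 u3 : G).
Hypothesis bbt : bipartite_but_three A H u1 u2 u3.

(** Each u has an anchor among its neighbours in A; this makes [degree_le]
   applicable. *)
Lemma L_degree u : u \in L -> (0 < dA u)%N.
Proof.
rewrite -compl_AH; case: bbt => _ _ _ -> _ _ _.
have [v13 [v23 [w13 [w23 anc]]]] := anchored_exist Gtf chi4 bbt.
case: anc => _ [v1A u1v u3v] [v2A u2v _] _ _.
rewrite !in_setU !in_set1 -orbA => /or3P[]/eqP->; apply/card_gt0P;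
  [exists v13|exists v23|exists v13]; by rewrite in_set ?u1v ?u2v ?u3v andbT.
Qed.

Lemma L_perron u : u \in L -> rho * x u <= 42.
Proof.
move=> uL; have := degree_le _ (L_degree uL).
move: uL; rewrite inE => /andP[uB du] /(_ uB) h; apply: le_trans h _.
have : (dA u)%:R <= 26 :> R by rewrite (ler_nat _ _ 26).
lra.
Qed.

Let rho_gt0 : 0 < rho.
Proof. by apply: lt_le_trans rho_ge; lra. Qed.

Lemma L_perron_sum : rho * \sum_(u in L) x u <= 126.
Proof.
rewrite mulr_sumr; apply: (@le_trans _ _ (\sum_(u in L) 42)).
  by apply: ler_sum => u; apply: L_perron.
by rewrite sumr_const card_L; lra.
Qed.

Lemma L_perron_degree_sum : rho * \sum_(u in L) (dA u)%:R * x u <= 3276.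
Proof.
rewrite mulr_sumr; apply: (@le_trans _ _ (\sum_(u in L) 26 * 42)).
  apply: ler_sum => u uL; rewrite mulrCA; apply: ler_pM; rewrite ?ler0n //.
  - by apply: mulr_ge0 => //; exact: ltW.
  - by rewrite (ler_nat _ _ 26); move: uL; rewrite inE => /andP[].
  - exact: L_perron.
by rewrite sumr_const card_L; lra.
Qed.

Lemma rho2_split : rho ^+ 2
  = \sum_(w in H) (dA w)%:R * x w + \sum_(u in L) (dA u)%:R * x u.
Proof.
rewrite rho2_sum (bigID (fun w => (26 < dA w)%N)) /=; congr (_ + _).
  by apply: eq_bigl => w; rewrite [RHS]in_set.
by apply: eq_bigl => w; rewrite [RHS]in_set -leqNgt.
Qed.

Lemma H_perron_sum : rho - 9 <= \sum_(w in H) x w.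
Proof.
have s_ge0 : 0 <= \sum_(w in H) x w by apply: sumr_ge0.
have h1 : \sum_(w in H) (dA w)%:R * x w <= a * \sum_(w in H) x w.
  rewrite mulr_sumr; apply: ler_sum => w _; apply: ler_wpM2r => //.
  by rewrite ler_nat subset_leq_card //; apply/subsetP => z; rewrite in_set => /andP[].
have h2 := L_perron_degree_sum; have h3 := rho2_split.
have /andP[_ a2] := a_near.
move: s_ge0 h1 h2 h3 a2 rho_ge; move: (\sum_(w in H) x w) => s.
move: (\sum_(w in H) _) (\sum_(u in L) _) => p q; rewrite -/rho; move: rho => r.
exact: near_sum.
Qed.

(** The total weight of H is close to rho, and z misses at most 16 of its
   vertices. *)
Lemma A_perron z : z \in A -> rho - 25 <= rho * x z.
Proof.
move=> zA; rewrite -xA.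
apply: (@le_trans _ _ (\sum_(w in H | adj z w) x w)); last first.
  rewrite [leRHS](bigID (mem H)) /= [X in X + _](eq_bigl (fun w => (w \in H) && adj z w)).
    by rewrite lerDl sumr_ge0.
  by move=> w; rewrite andbC.
have := H_perron_sum; rewrite (bigID (adj z)) /=.
have : \sum_(w in H | ~~ adj z w) x w <= 16.
  apply: (@le_trans _ _ (\sum_(w in H | ~~ adj z w) 1)); first exact: ler_sum.
  rewrite sumr_const (ler_nat _ _ 16); apply: leq_trans (misses_le zA).
  apply: subset_leq_card; apply/subsetP => w; rewrite -topredE /= !in_set.
  by move=> /andP[/andP[-> _] ->].
lra.
Qed.

(** Compare the eigenvalue equations at v0 and at w: the difference is the weight
   of the nonneighbours of w in A, up to the small weight of L. *)
Lemma H_deficit w : w \in H ->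
  (a - (dA w)%:R) * (rho - 25) - 126 <= rho ^+ 2 * (1 - x w).
Proof.
move=> wH.
have e : rho * (1 - x w) = \sum_(z in A | ~~ adj w z) x z - \sum_(z in L | adj w z) x z.
  rewrite mulrBr mulr1 -xA {1}rho_sum (bigID (adj w)) /=.
  rewrite [X in _ - X](bigID (mem A)) /=.
  rewrite [X in _ - (X + _)](eq_bigl (fun z => (z \in A) && adj w z)); last first.
    by move=> z; rewrite andbC.
  rewrite [X in _ - (_ + X)](eq_bigl (fun z => (z \in L) && adj w z)); last first.
    move=> z; rewrite -compl_AH in_setC in_setU negb_or andbC.
    have [wz|] := boolP (adj w z); last by rewrite !andbF.
    have -> : z \notin H by apply: contraL wz => zH; rewrite H_independent.
    by rewrite !andbT.
  ring.
have h1 : (a - (dA w)%:R) * (rho - 25) <= rho * \sum_(z in A | ~~ adj w z) x z.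
  have -> : a - (dA w)%:R = #|[set z in A | ~~ adj w z]|%:R.
    rewrite /a (cardsID_pred A (adj w)) natrD -/dA; ring.
  rewrite mulr_natl -sumr_const mulr_sumr.
  rewrite (eq_bigl (fun z => (z \in A) && ~~ adj w z)); last by move=> z; rewrite inE.
  by apply: ler_sum => z /andP[zA _]; apply: A_perron.
have h2 : rho * \sum_(z in L | adj w z) x z <= 126.
  apply: le_trans L_perron_sum; apply: ler_wpM2l; first exact: ltW.
  rewrite [leRHS](bigID (adj w)) /= lerDl sumr_ge0 //.
have -> : rho ^+ 2 * (1 - x w) = rho * (rho * (1 - x w)) by ring.
rewrite e mulrBr; lra.
Qed.

Lemma H_term w : w \in H -> (dA w)%:R * x w
  <= a - 2 * (a - (dA w)%:R) + 194 * (a - (dA w)%:R) / rho.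
Proof.
move=> wH; have dle : (dA w <= #|A|)%N.
  by apply: subset_leq_card; apply/subsetP => z; rewrite in_set => /andP[].
have m01 : a - (dA w)%:R = 0 \/ 1 <= a - (dA w)%:R.
  rewrite /a -natrB //; case: (_ - _)%N => [|k]; [by left|right].
  by rewrite (ler_nat _ 1).
have := deficit_sum rho_ge (H_degree wH) (x01 w) m01 (H_deficit wH).
rewrite [X in _ <= X -> _]mulrBr mulr1; lra.
Qed.

Lemma rho2_upper : rho ^+ 2 < a * b - 2 * #|nonedges A H|%:R + 3 / 4.
Proof.
rewrite rho2_split.
have h1 : \sum_(w in H) (dA w)%:R * x w
    <= a * b - 2 * #|nonedges A H|%:R + 194 * #|nonedges A H|%:R / rho.
  apply: le_trans (ler_sum _ H_term) _.
  rewrite card_nonedges -/a -/dA big_split /= sumrB -mulr_sumr -mulr_suml -mulr_sumr.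
  by rewrite sumr_const -[X in X - _]mulr_natr card_H_b.
have h2 := L_perron_degree_sum; have h3 := nonedges_le.
move: h1 h2 h3 rho_ge rho_gt0; rewrite -/rho.
move: (\sum_(w in H) _) (\sum_(u in L) _) (a * b) (#|_|%:R) rho.
exact: error_bound.
Qed.

Lemma stable_parameters :
  #|nonedges A H| = 6 /\ (#|A| * #|H| = M)%N.
Proof.
have [m6 _] := six_nonedges Gtf chi4 bbt.
have abM : (#|A| * #|H| <= M)%N.
  by rewrite -(ler_nat R) natrM card_H_b product_le_MR.
have cast (p q m : nat) : p%:R - 49 / 4 < q%:R - 2 * m%:R + 3 / 4 :> R ->
    (p + 2 * m < q + 13)%N.
  move=> h; rewrite -(ltr_nat R) natrD [(q + _)%:R]natrD natrM; lra.
have : (M + 2 * #|nonedges A H| < #|A| * #|H| + 13)%N.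
  apply: cast; rewrite [X in _ < X - _ + _]natrM card_H_b.
  exact: le_lt_trans rhoM rho2_upper.
move: m6 abM.
have tight (m p q : nat) : (6 <= m)%N -> (p <= q)%N -> (q + 2 * m < p + 13)%N ->
  m = 6 /\ p = q by lia.
exact: tight.
Qed.

End Upper.

End Perron.
Theorem stability (M := ((#|G| - 3)./2 * uphalf (#|G| - 3))%N) :
    30 * 1000 <= spectral_radius R G ->
    M%:R - 49 / 4 <= spectral_radius R G ^+ 2 ->
  exists (A H : {set G}) u1 u2 u3, [/\ bipartite_but_three A H u1 u2 u3,
    #|nonedges A H| = 6, (#|A| + #|H| = #|G| - 3)%N & (#|A| * #|H| = M)%N].
Proof.
move=> rho_ge rhoM; have G_gt0 : (0 < #|G|)%N.
  have i0 : independent (set0 : {set G}) by move=> a b; rewrite inE.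
  exact: leq_trans (ltnW (ltnW (three_outside Gtf chi4 i0 i0))) (max_card _).
have [x [v0 [xv0 x01 xA]]] := perron R G_gt0.
have H_independent' := H_independent x01 xv0 xA rho_ge rhoM.
have iA : independent [set w | adj v0 w].
  by move=> a b; rewrite !inE => va; apply: tf; rewrite adj_sym.
have [|u1 [u2 [u3 bbt]]] := bbt_exists Gtf chi4 iA H_independent' (disjoint_AH v0).
  by rewrite compl_AH; apply: card_L xA rho_ge rhoM.
have [m6 abM] := stable_parameters x01 xv0 xA rho_ge rhoM bbt.
by eexists _, _, u1, u2, u3; split; [exact: bbt|exact: m6|exact: card_H xA rho_ge rhoM|].
Qed.

End Stability.

(** * The extremal graph *)

Lemma lower_numeric (R : realType) (r M N : R) : 60 * 1001 <= N ->
    N ^+ 2 <= 4 * M + 1 -> 2 * (M - 6) <= r * N ->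
  30 * 1000 <= r /\ M - 49 / 4 <= r ^+ 2.
Proof.
move=> N_ge NM rN; have N0 : 0 < N by lra.
have M_ge : 13 <= M by nra.
split.
  rewrite -(ler_pM2r N0); apply: le_trans rN; nra.
have r2 : (2 * (M - 6)) ^+ 2 <= r ^+ 2 * (4 * M + 1).
  apply: (@le_trans _ _ (r ^+ 2 * N ^+ 2)).
    by rewrite -exprMn ler_pXn2r // ?nnegrE; lra.
  by apply: ler_wpM2l => //; apply: sqr_ge0.
have M0 : 0 < 4 * M + 1 by lra.
rewrite -(ler_pM2r M0); apply: le_trans r2; nra.
Qed.

Lemma halves_unique (a b N : nat) : (a + b = N)%N ->
    (a * b = N./2 * uphalf N)%N ->
  (a = N./2 /\ b = uphalf N) \/ (a = uphalf N /\ b = N./2).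
Proof.
move=> abN; rewrite uphalf_half; have := odd_double_half N.
move: (odd N) (N./2) => o h; rewrite -addnn => e ab.
by case: o e ab => /= e ab; nia.
Qed.

Lemma F1_parameters (n : nat) : (30 <= n)%N ->
  [/\ ((n - 11)./2 = (n - 3)./2 - 4)%N, (uphalf (n - 7) = uphalf (n - 3) - 2)%N,
      (4 < (n - 3)./2)%N & (2 < uphalf (n - 3))%N].
Proof. by move=> n30; split; lia. Qed.

(** When n - 3 is odd, the second candidate left by [six_nonedges] has a smaller
   spectral radius than the first. *)
Lemma extremal_isomorphic (R : realType) (n : nat) (G : sgraph) :
    let F := F1_blow_up ((n - 11)./2)%N (uphalf (n - 7))%N in
    (60 * 1010 <= n)%N -> #|G| = n -> triangle_free G ->
    (4 <= chromatic_number G)%N ->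
  spectral_radius R F <= spectral_radius R G -> isomorphic G F.
Proof.
move=> F n_ge Gn Gtf chi4; rewrite /F.
have n30 : (30 <= n)%N by apply: leq_trans n_ge; rewrite -[30%N]muln1 leq_mul.
have [-> -> s_gt t_gt] := F1_parameters n30.
set N := (n - 3)%N in s_gt t_gt *; set r := spectral_radius R (F1_blow_up _ _).
move=> le_rG; pose M := (N./2 * uphalf N)%N.
have NE : (N./2 + uphalf N)%N = N by rewrite uphalf_half addnCA addnn odd_double_half.
have [r_ge rM] : 30 * 1000 <= r /\ M%:R - 49 / 4 <= r ^+ 2.
  have := F1_blow_up_lower R (N./2 - 4) (uphalf N - 2); rewrite -/r.
  rewrite !natrB ?(ltnW s_gt) ?(ltnW t_gt) // => low.
  have eN : N./2%:R + (uphalf N)%:R = N%:R :> R by rewrite -natrD NE.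
  apply: (@lower_numeric _ _ _ N%:R).
  - rewrite (_ : 60 * 1001 = (60 * 1001)%:R) ?ler_nat ?natrM //.
    by rewrite /N leq_subRL; lia.
  - rewrite -natrX (_ : 4 * _ + 1 = (4 * M + 1)%:R) ?ler_nat; last first.
      by rewrite natrD natrM.
    rewrite -{1}NE /M uphalf_half; move: (odd N) (N./2) => o h.
    by rewrite -mulnn; case: o => /=; nia.
  - rewrite -eN /M natrM; move: low; lra.
have rG0 : 0 <= r by lra.
have [|A [H [u1 [u2 [u3 [bbt m6 AH_N AH_M]]]]]] :=
  stability (R := R) Gtf chi4 (le_trans r_ge le_rG).
  rewrite Gn; apply: le_trans rM _.
  by rewrite ler_pXn2r // nnegrE // (le_trans rG0).
rewrite Gn -/N in AH_N AH_M.
have [_ /(_ m6) iso] := six_nonedges Gtf chi4 bbt.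
have [N_even|N_odd] := boolP (~~ odd N).
  have eq_half : uphalf N = N./2 by rewrite uphalf_half (negPf N_even).
  have [AE HE] : #|A| = N./2 /\ #|H| = N./2.
    by case: (halves_unique AH_N AH_M) => -[-> ->]; rewrite eq_half.
  by rewrite eq_half; case: iso; rewrite AE HE.
rewrite negbK in N_odd.
pose k := N./2; have kE : uphalf N = k.+1 by rewrite uphalf_half N_odd.
have k20 : (20 <= k)%N by rewrite /k /N; lia.
have wrong : ~ isomorphic G (F1_blow_up (k.+1 - 4) (k - 2)).
  move=> /(iso_spectral_radius R); have := F1_sides_compare R k20.
  rewrite subSS; move: le_rG; rewrite /r kE subSS -/k => le lt e.
  by move: (lt_le_trans lt le); rewrite e ltxx.
have half : N./2 = k by [].
case: (halves_unique AH_N AH_M) => -[AE HE]; case: iso; rewrite AE HE ?kE ?half //.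
Qed.

Theorem theorem1p4 (R : realType) :
  exists n0 : nat, forall n : nat, (n0 <= n)%N ->
    let F := F1_blow_up ((n - 11)./2)%N (uphalf (n - 7))%N in
    [/\ #|F| = n, triangle_free F, (4 <= chromatic_number F)%N &
      forall G : sgraph,
        #|G| = n -> triangle_free G -> (4 <= chromatic_number G)%N ->
        spectral_radius R G <= spectral_radius R F /\
        (spectral_radius R G = spectral_radius R F <-> isomorphic G F)].
Proof.
(* The estimates need rho(F) >= 30 * 1000, and rho(F) is about n / 2. *)
exists (60 * 1010)%N => n n_ge F.
have n30 : (30 <= n)%N by apply: leq_trans n_ge; rewrite -[30%N]muln1 leq_mul.
have extremal := @extremal_isomorphic R n _ n_ge.
split.
- by rewrite card_F1_blow_up; move: n30; clear; lia.
- exact/blow_up_triangle_free/F1_triangle_free.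
- by apply: F1_blow_up_chromatic; move: n30; clear; lia.
move=> G Gn Gtf chi4; have {}extremal := extremal G Gn Gtf chi4; split.
  have [//|lt_FG] := leP (spectral_radius R G) (spectral_radius R F).
  by move: (lt_FG); rewrite (iso_spectral_radius R (extremal (ltW lt_FG))) ltxx.
split=> [eq_GF|]; last exact: iso_spectral_radius.
by apply: extremal; rewrite -/F eq_GF.
Qed.
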